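(* Let $\Psi\in\mathbb{C}^{q\times q}\langle\langle z_1,\ldots,z_N\rangle\rangle_{\rm rat}$ be a rational formal power series and let $\alpha=(N;A,B,C,D;\mathbb{C}^\gamma=\bigoplus_{k=1}^N\mathbb{C}^{\gamma_k},\mathbb{C}^q)$ be a minimal GR-realization of $\Psi$. Then $\Psi$ is matrix-selfadjoint on $\mathcal{T}_N$ (that is, for all $n\in\mathbb{N}$ one has $\Psi(Z)=\Psi(Z)^*$ at all points $Z\in(\mathbb{T}^{n\times n})^N$ where $\Psi$ is defined) if and only if there exists an invertible Hermitian matrix $H={\rm diag}(H_1,\ldots,H_N)$, with $H_k\in\mathbb{C}^{\gamma_k\times\gamma_k}$, $k=1,\ldots,N$, such that $$A^*HA=H,\quad D-D^*=iB^*HB,\quad C=iB^*HA.$$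
   Context: Formal power series. $\mathcal{F}_N$ is the free monoid on generators $g_1,\ldots,g_N$ with empty word $\emptyset$. A formal power series (FPS) in non-commuting indeterminates $z_1,\ldots,z_N$ is $f(z)=\sum_{w\in\mathcal{F}_N}f_wz^w$, where $z^w=z_{i_1}\cdots z_{i_n}$ for $w=g_{i_1}\cdots g_{i_n}$; the indeterminates commute with coefficients and products are by convolution over factorizations of words. A scalar FPS is rational if it is obtained from non-commutative polynomials by finitely many sums, products and inversions (of FPSs with non-zero constant term); a matrix FPS is rational if all its entries are. GR-nodes. A GR-node $\alpha=(N;A,B,C,D;\mathbb{C}^r=\bigoplus_{k=1}^N\mathbb{C}^{r_k},\mathbb{C}^q)$ consists of matrices $A\in\mathbb{C}^{r\times r}$, $B\in\mathbb{C}^{r\times q}$, $C\in\mathbb{C}^{q\times r}$, $D\in\mathbb{C}^{q\times q}$, with blocks $A_{ij},B_i,C_j$ along the decomposition of $\mathbb{C}^r$. Its transfer function is the rational FPS $T^{\rm nc}_\alpha(z)=D+C(I_r-\Delta(z)A)^{-1}\Delta(z)B$ with $\Delta(z)={\rm diag}(z_1I_{r_1},\ldots,z_NI_{r_N})$, i.e. the coefficient at $\emptyset$ is $D$ and at $w=g_{j_1}\cdots g_{j_n}$ it is $C_{j_1}A_{j_1j_2}\cdots A_{j_{n-1}j_n}B_{j_n}$. $\alpha$ is a GR-realization of $\Psi$ if $T_\alpha^{\rm nc}=\Psi$; it is minimal if each $r_k$ is the smallest possible among all GR-realizations of $\Psi$. For minimal realizations one writes $\gamma_k$ for $r_k$ and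 $\gamma=\sum_k\gamma_k$. Evaluation. For $Z=(Z_1,\ldots,Z_N)\in(\mathbb{C}^{n\times n})^N$, $\Psi(Z)$ is obtained by substituting $Z_k$ for $z_k$ in a rational expression for $\Psi$; near $Z=0$ it equals $\sum_w\Psi_w\otimes Z^w$, and it is a $\mathbb{C}^{q\times q}\otimes\mathbb{C}^{n\times n}$-valued rational function of the entries of the $Z_k$, defined (holomorphic) on an open dense set containing a neighbourhood of $0$. $\mathbb{T}^{n\times n}$ is the set of unitary $n\times n$ complex matrices and $\mathcal{T}_N=\coprod_{n\in\mathbb{N}}(\mathbb{T}^{n\times n})^N$. *)

(* Defs.v *)
From HB Require Import structures.
From mathcomp Require Import all_boot all_order all_algebra.
From mathcomp Require Import reals.
From mathcomp Require Import complex mpoly.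

Set Implicit Arguments.
Unset Strict Implicit.
Unset Printing Implicit Defensive.

Import Order.TTheory GRing.Theory Num.Theory.
Local Open Scope ring_scope.
Local Open Scope sesquilinear_scope.

(* The letter i of a word stands for the generator g_(i+1); the empty word is
   [::].  A formal power series is its family of coefficients. *)
Definition word (N : nat) := seq 'I_N.
Definition fps (C : Type) (N : nat) := word N -> C.
Definition mxfps (C : Type) (N q : nat) := word N -> 'M[C]_q.

Inductive rexpr (C : Type) (N : nat) : Type :=
  | RConst of C
  | RVar of 'I_N
  | RAdd of rexpr C N & rexpr C N
  | RMul of rexpr C N & rexpr C N
  | RInv of rexpr C N.

Section FormalPowerSeries.
Variables (C : nzRingType) (N : nat).
Implicit Types (f g : fps C N) (e : rexpr C N).

Definition fps_const (c : C) : fps C N :=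
  fun w => if w is [::] then c else 0.

Definition fps_var (i : 'I_N) : fps C N := fun w => (w == [:: i])%:R.

Definition fps_add f g : fps C N := fun w => f w + g w.

Definition fps_mul f g : fps C N :=
  fun w => \sum_(k < (size w).+1) f (take k w) * g (drop k w).

(* [represents e f]: all the inversions in e are of series with non-zero
   constant term, and e, read as an expression in formal power series,
   equals f. *)
Fixpoint represents e f : Prop :=
  match e with
  | RConst c => f =1 fps_const c
  | RVar i => f =1 fps_var i
  | RAdd e1 e2 => exists f1 f2,
      [/\ represents e1 f1, represents e2 f2 & f =1 fps_add f1 f2]
  | RMul e1 e2 => exists f1 f2,
      [/\ represents e1 f1, represents e2 f2 & f =1 fps_mul f1 f2]
  | RInv e1 => exists f1,
      [/\ represents e1 f1, f1 [::] != 0,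
          fps_mul f1 f =1 fps_const 1 & fps_mul f f1 =1 fps_const 1]
  end.

Definition fps_rational f : Prop := exists e, represents e f.

Definition mxfps_rational q (Psi : mxfps C N q) : Prop :=
  forall a b, fps_rational (fun w => Psi w a b).

End FormalPowerSeries.

Section GRNodes.
Variables (C : nzRingType) (N q : nat).

Record gr_node (r : 'I_N -> nat) : Type := GRNode {
  gr_A : 'M[C]_(\sum_(k < N) r k);
  gr_B : 'M[C]_(\sum_(k < N) r k, q);
  gr_C : 'M[C]_(q, \sum_(k < N) r k);
  gr_D : 'M[C]_q
}.

(* gr_tail j [:: j_2; ...; j_n] = A_{j j_2} A_{j_2 j_3} ... B_{j_n} *)
Fixpoint gr_tail r (alpha : gr_node r) (j : 'I_N) (w : word N) : 'M[C]_(r j, q) :=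
  if w is j' :: w' then submxblock (gr_A alpha) j j' *m gr_tail alpha j' w'
  else submxcol (gr_B alpha) j.

Definition transfer r (alpha : gr_node r) : mxfps C N q :=
  fun w => if w is j :: w' then submxrow (gr_C alpha) j *m gr_tail alpha j w'
           else gr_D alpha.

Definition gr_realization (Psi : mxfps C N q) r (alpha : gr_node r) : Prop :=
  transfer alpha =1 Psi.

Definition minimal_gr_realization (Psi : mxfps C N q) r (alpha : gr_node r) : Prop :=
  gr_realization Psi alpha /\
  forall (r' : 'I_N -> nat) (beta : gr_node r'), gr_realization Psi beta ->
    forall k, (r k <= r' k)%N.

End GRNodes.

(* Substitution of n x n matrices over an extension phi : C -> K.  The junk
   value of invmx on singular matrices is never met below, where expressions
   representing a power series are evaluated at generic matrices: there, the
   argument of every inversion has a determinant which does not vanish at 0. *)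
Fixpoint reval (C : Type) (K : fieldType) (phi : C -> K) (N n : nat)
    (X : 'I_N -> 'M[K]_n) (e : rexpr C N) : 'M[K]_n :=
  match e with
  | RConst c => (phi c)%:M
  | RVar i => X i
  | RAdd e1 e2 => reval phi X e1 + reval phi X e2
  | RMul e1 e2 => reval phi X e1 *m reval phi X e2
  | RInv e1 => invmx (reval phi X e1)
  end.

Section Evaluation.
Variables (C : fieldType) (N n : nat).

(* One commuting variable for each entry of each of the N matrices. *)
Definition entry : finType := ('I_N * 'I_n * 'I_n)%type.
Definition ratfun : fieldType := {fraction {mpoly C[#|entry|]}}.

Definition ratfun_const (c : C) : ratfun := tofrac (c%:MP_[#|entry|]).

Definition generic_mx (k : 'I_N) : 'M[ratfun]_n :=
  \matrix_(i, j) tofrac ('X_(enum_rank ((k, i, j) : entry)) : {mpoly C[#|entry|]}).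

Definition coords (Z : 'I_N -> 'M[C]_n) : 'I_#|entry| -> C :=
  fun m => let: (k, i, j) := (enum_val m : entry) in Z k i j.

(* The rational function x is regular (equivalently, holomorphic) at Z, with
   value v there. *)
Definition ratfun_value (x : ratfun) (Z : 'I_N -> 'M[C]_n) (v : C) : Prop :=
  exists p d : {mpoly C[#|entry|]},
    [/\ d.@[coords Z] != 0, x = tofrac p / tofrac d & v = p.@[coords Z] / d.@[coords Z]].

(* C^{q x q} (x) C^{n x n} is identified with the q x q block matrices with
   blocks of size n x n, so that M (x) Y has the blocks M a b *: Y. *)
Definition rational_mxfun q (E : 'I_q -> 'I_q -> rexpr C N) :
    'M[ratfun]_(\sum_(a < q) n) :=
  \mxblock_(a < q, b < q) reval ratfun_const generic_mx (E a b).

(* [mxfps_value Psi Z V]: Psi is defined at Z, and Psi(Z) = V. *)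
Definition mxfps_value q (Psi : mxfps C N q) (Z : 'I_N -> 'M[C]_n)
    (V : 'M[C]_(\sum_(a < q) n)) : Prop :=
  exists E : 'I_q -> 'I_q -> rexpr C N,
    (forall a b, represents (E a b) (fun w => Psi w a b)) /\
    (forall s t, ratfun_value (rational_mxfun E s t) Z (V s t)).

End Evaluation.

Definition matrix_selfadjoint_on_T (C : numClosedFieldType) (N q : nat)
    (Psi : mxfps C N q) : Prop :=
  forall n : nat, (0 < n)%N ->
  forall Z : 'I_N -> 'M[C]_n, (forall k, Z k \is unitarymx) ->
  forall V, mxfps_value Psi Z V -> V = V^t*.

(* Main.v *)
(* If A^*HA = H, D - D^* = iB^*HB and C = iB^*HA, a direct computation shows that
   Psi(Z) is Hermitian at the unitary Z where I - A Delta(Z) is invertible; at the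
   other unitary points where Psi is defined one replaces Z by cZ with |c| = 1 and
   uses that a rational identity in c persists at c = 1.

   Conversely, choose l on the unit circle which is not an eigenvalue of A. The Cayley
   transform Z = l^-1 (I - iS)(I + iS)^-1 maps Hermitian S to unitary Z and turns alpha
   into a node, again controllable and observable, whose transfer function Phi takes
   Hermitian values at Hermitian S. For a tuple W = S1 + iS2 of nilpotent matrices,
   the values at S1 + tS2 for real t and polynomial continuation to t = i and t = -i
   show that Phi(W) is the adjoint of the value of Phi at W^*. When W consists of the
   shifts along a word w, this reads Phi_w = (Phi_(reversed w))^*. Hence the transformed
   node and its adjoint realize the same power series, and the block diagonal similarity
   between them yields H.

   A rational expression representing Psi agrees with the realization at generic
   matrices, since both have the Taylor expansion \sum_w Psi_w X^w at 0. *)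
Require Import Defs.
From mathcomp Require Import all_boot all_order all_algebra.
From mathcomp Require Import reals complex mpoly mxtens boolp zify ring.
Set Implicit Arguments.
Unset Strict Implicit.
Unset Printing Implicit Defensive.
Import Order.TTheory GRing.Theory Num.Theory.
Local Open Scope ring_scope.
Local Open Scope sesquilinear_scope.

(** * Controllability and tails *)

Section SpanOfFamily.
Variables (F : fieldType) (T : Type) (m n : nat) (g : T -> 'M[F]_(m, n)).

(** Membership in the span of the columns of all the [g t]. The index type may be infinite, as it is
    for words, and the finitely many coefficients remain available for building linear maps. *)
Definition colcomb p (K : 'M[F]_(m, p)) :=
  exists c : seq (T * 'M[F]_(n, p)), K = \sum_(v <- c) g v.1 *m v.2.

Lemma colcombD p (K L : 'M[F]_(m, p)) : colcomb K -> colcomb L -> colcomb (K + L).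
Proof. by move=> [c ->] [d ->]; exists (c ++ d); rewrite big_cat. Qed.

Lemma colcombM p s (K : 'M[F]_(m, p)) (X : 'M_(p, s)) : colcomb K -> colcomb (K *m X).
Proof.
move=> [c ->]; exists [seq (v.1, v.2 *m X) | v <- c].
by rewrite big_map mulmx_suml; apply: eq_bigr => v _; rewrite mulmxA.
Qed.

Lemma colcomb1 t p (X : 'M_(n, p)) : colcomb (g t *m X).
Proof. by exists [:: (t, X)]; rewrite big_seq1. Qed.

(** Adjoining a [g t] not yet covered raises the rank, which is at most [m]; hence finitely many
    members of the family already span everything. *)
Lemma colspan_family :
  exists2 K : 'M[F]_m, colcomb K & forall t, ((g t)^T <= K^T)%MS.
Proof.
suff H k : forall K : 'M[F]_m, colcomb K -> (m - \rank K^T <= k)%N ->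
    exists2 K : 'M[F]_m, colcomb K & forall t, ((g t)^T <= K^T)%MS.
  by apply: (H m 0); [exists [::]; rewrite big_nil | exact: leq_subr].
elim: k => [|k IHk] K cK rK.
  exists K => // t; apply: submx_full.
  by rewrite /row_full eqn_leq rank_leq_col -subn_eq0 -leqn0.
have [KP|/existsNP[t gt]] := pselect (forall t, ((g t)^T <= K^T)%MS).
  by exists K.
(* The row sum is again a square matrix; its coefficients [u], [v] show that its transpose is still
   a combination of the family. *)
have [[u v] /= def] := sub_addsmxP (submx_refl (K^T + (g t)^T)%MS).
apply: (IHk ((K^T + (g t)^T)%MS)^T).
  rewrite def raddfD /= !trmx_mul !trmxK; apply: colcombD.
    exact: colcombM.
  exact: colcomb1.
rewrite trmxK.
have lt : (\rank K^T < \rank (K^T + (g t)^T)%MS)%N.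
  apply: rank_ltmx; rewrite ltmxE addsmxSl /=.
  by apply/negP => /(submx_trans (addsmxSr _ _)) /gt.
by move: rK lt (rank_leq_col (K^T + (g t)^T)%MS); lia.
Qed.

(** Duality: the rows of [(cokermx K^T)^T] annihilate the family, and what they annihilate is
    exactly the column space of [K]. *)
Lemma colcomb_spanning p (Q : 'M[F]_(m, p)) :
  (forall x : 'M_m, (forall t, x *m g t = 0) -> x *m Q = 0) -> colcomb Q.
Proof.
move=> gQ; have [K cK Kg] := colspan_family.
suff /submxP[Y /(congr1 trmx)] : (Q^T <= K^T)%MS.
  by rewrite trmx_mul !trmxK => ->; apply: colcombM.
have K0 : (cokermx K^T)^T *m K = 0.
  by apply: trmx_inj; rewrite trmx_mul trmxK trmx0 mulmx_coker.
rewrite submxE -[Q^T *m _]trmxK trmx_mul trmxK gQ ?trmx0 // => t.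
have /submxP[Y /(congr1 trmx)] := Kg t.
by rewrite trmxK trmx_mul trmxK => ->; rewrite mulmxA K0 mul0mx.
Qed.

End SpanOfFamily.

Definition block_projectors (F : fieldType) (N r : nat) (P : 'I_N -> 'M[F]_r) :=
  (forall j k, P j *m P k = if j == k then P k else 0) /\ \sum_k P k = 1%:M.

(** The dual form of controllability: the row space of [K] stands for a subspace invariant under [A]
    and the [P k] and annihilating [B]. For the pair [A^t*], [G^t*] it expresses observability. *)
Definition controllable (F : fieldType) (N r q : nat) (P : 'I_N -> 'M[F]_r)
    (A : 'M[F]_r) (B : 'M[F]_(r, q)) :=
  forall K : 'M[F]_r, (forall k, (K *m P k <= K)%MS) -> (K *m A <= K)%MS ->
    K *m B = 0 -> K = 0.

Section Tails.
Variables (F : fieldType) (N r q : nat) (P : 'I_N -> 'M[F]_r).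
Hypothesis P_proj : block_projectors P.
Variables (A : 'M[F]_r) (B : 'M[F]_(r, q)).

(** Unlike in [gr_tail], no block row is selected at the front; a factor [P k] on the left does
    that. *)
Fixpoint tail (w : word N) : 'M[F]_(r, q) :=
  if w is j :: w' then A *m P j *m tail w' else B.

Lemma sum_proj m (X : 'M[F]_(m, r)) : X = \sum_k X *m P k.
Proof. by rewrite -mulmx_sumr P_proj.2 mulmx1. Qed.

Lemma eq_from_proj m (X Y : 'M[F]_(m, r)) :
  (forall k, X *m P k = Y *m P k) -> X = Y.
Proof. by move=> XY; rewrite (sum_proj X) (sum_proj Y); apply: eq_bigr. Qed.

(** The left annihilator of all [P j *m tail w] is invariant under [A], since multiplying by [A]
    prolongs the word by a letter, and under the [P j], and it kills [B]; so controllability makes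
    it zero. *)
Lemma controllable_tail : controllable P A B ->
  forall m k (x : 'M[F]_(m, r)), (forall w, x *m P k *m tail w = 0) -> x *m P k = 0.
Proof.
move=> AB m k x xw.
(* One matrix [K] encodes the infinitely many conditions: its left kernel is the annihilator. *)
have [K [c defK] KP] := colspan_family (fun t : 'I_N * word N => P t.1 *m tail t.2).
have K0 p (y : 'M[F]_(p, r)) :
    y *m K = 0 <-> forall j w, y *m P j *m tail w = 0.
  split=> [yK j w|yP].
    have /submxP[Y /(congr1 trmx)] := KP (j, w).
    rewrite trmxK trmx_mul trmxK /= => e.
    by rewrite -mulmxA e mulmxA yK mul0mx.
  rewrite defK mulmx_sumr big1 // => -[[j w] X] _ /=.
  by rewrite !mulmxA yP mul0mx.
suff L0 : kermx K = 0.
  apply/eqP; rewrite -submx0 -L0; apply/sub_kermxP/K0 => j w.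
  rewrite -(mulmxA x) P_proj.1; case: eqP => [<-|_]; last by rewrite mulmx0 mul0mx.
  exact: xw.
have kK0 : forall j w, kermx K *m P j *m tail w = 0 by apply/K0/mulmx_ker.
apply: AB => [j||].
- apply/sub_kermxP/K0 => i w; rewrite -(mulmxA (kermx K)) P_proj.1.
  by case: eqP => [<-|_]; rewrite ?mulmx0 ?mul0mx ?kK0.
- apply/sub_kermxP/K0 => i w.
  rewrite {1}[kermx K]sum_proj !mulmx_suml big1 // => j _.
  by have := kK0 j (i :: w); rewrite /= !mulmxA.
- rewrite {1}[kermx K]sum_proj mulmx_suml big1 // => j _.
  exact: (kK0 j [::]).
Qed.

Lemma controllable_eq m (X Y : 'M[F]_(m, r)) : controllable P A B ->
  (forall k w, X *m P k *m tail w = Y *m P k *m tail w) -> X = Y.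
Proof.
move=> AB XY; apply: eq_from_proj => k; apply/eqP; rewrite -subr_eq0 -mulmxBl.
apply/eqP/controllable_tail => // w.
by rewrite !mulmxBl XY subrr.
Qed.

End Tails.

(** [G] preserves rank, so the inclusion of [K *m G] in [K] is an equality of row spaces. *)
Lemma submx_mul_inv (F : fieldType) r (K G : 'M[F]_r) :
  G \in unitmx -> (K *m G <= K)%MS -> (K *m invmx G <= K)%MS.
Proof.
move=> uG KG.
have KGK : (K <= K *m G)%MS.
  by rewrite -(geq_leqif (mxrank_leqif_sup KG)) mxrankMfree // row_free_unit.
by rewrite -[X in (_ <= X)%MS](mulmxK uG) submxMr.
Qed.

(* Subspaces invariant under a resolvent [R] of [A] are invariant under [A]. *)
Lemma controllable_resolvent (F : fieldType) (N r q : nat) (P : 'I_N -> 'M[F]_r)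
    (A R : 'M[F]_r) (B : 'M[F]_(r, q)) (l a b c : F) :
  R *m (l%:M - A) = 1%:M -> a != 0 -> c != 0 ->
  controllable P A B -> controllable P (a *: R + b%:M) (c *: (R *m B)).
Proof.
move=> RA a0 c0 AB K KP KA KB; have uR := (mulmx1_unit RA).1.
have invR : invmx R = l%:M - A.
  by rewrite -[LHS]mulmx1 -RA mulKmx.
have KR : (K *m R <= K)%MS.
  have -> : K *m R = a^-1 *: (K *m (a *: R + b%:M)) - (a^-1 * b) *: K.
    rewrite mulmxDr scalerDr -scalemxAr scalerA mulVf // scale1r.
    by rewrite mul_mx_scalar scalerA addrK.
  by rewrite addmx_sub ?(eqmx_opp, scalemx_sub).
have := submx_mul_inv uR KR; rewrite invR => KlA.
apply: AB => //.
  have -> : K *m A = l *: K - K *m (l%:M - A).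
    by rewrite mulmxBr mul_mx_scalar subKr.
  by rewrite addmx_sub ?(eqmx_opp, scalemx_sub).
have KRB : K *m R *m B = 0.
  move: KB; rewrite -scalemxAr => /eqP; rewrite scaler_eq0 (negPf c0) /=.
  by rewrite mulmxA => /eqP.
(* The row space of [K] is invariant under [invmx R], so it lies in that of [K *m R], which
   annihilates [B]. *)
have /submxP[X defX] : (K <= K *m R)%MS.
  by rewrite -{1}[K](mulmxKV uR) submxMr ?invR.
by rewrite {1}defX -!mulmxA (mulmxA K) KRB mulmx0.
Qed.

(** * Similarity of a symmetric node with its adjoint *)

Section Adjoint.
Variable C : numClosedFieldType.

Lemma adjM m n p (X : 'M[C]_(m, n)) (Y : 'M_(n, p)) : (X *m Y)^t* = Y^t* *m X^t*.
Proof. by rewrite trmx_mul map_mxM. Qed.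

Lemma adjD m n (X Y : 'M[C]_(m, n)) : (X + Y)^t* = X^t* + Y^t*.
Proof. by rewrite linearD map_mxD. Qed.

Lemma adjN m n (X : 'M[C]_(m, n)) : (- X)^t* = - X^t*.
Proof. by rewrite linearN map_mxN. Qed.

Lemma adjZ m n c (X : 'M[C]_(m, n)) : (c *: X)^t* = c^* *: X^t*.
Proof. by rewrite linearZ map_mxZ. Qed.

Lemma adjK m n (X : 'M[C]_(m, n)) : X^t*^t* = X.
Proof. by apply/matrixP => i j; rewrite !mxE conjCK. Qed.

Lemma adjE m n (X : 'M[C]_(m, n)) i j : (X^t*) i j = (X j i)^*.
Proof. by rewrite !mxE. Qed.

Lemma adj_inj m n (X Y : 'M[C]_(m, n)) : X^t* = Y^t* -> X = Y.
Proof. by move=> XY; rewrite -[X]adjK XY adjK. Qed.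

Lemma adj_scalar n (c : C) : (c%:M : 'M_n)^t* = (c^*)%:M.
Proof. by rewrite tr_scalar_mx map_scalar_mx. Qed.

Lemma adj1 n : (1%:M : 'M[C]_n)^t* = 1%:M.
Proof. by rewrite adj_scalar rmorph1. Qed.

Lemma adj_sum m n (I : finType) (X : I -> 'M[C]_(m, n)) :
  (\sum_i X i)^t* = \sum_i (X i)^t*.
Proof. by rewrite linear_sum /= (raddf_sum (map_mx _)). Qed.

Lemma adj_inv n (X : 'M[C]_n) : (invmx X)^t* = invmx (X^t*).
Proof. by rewrite trmx_inv map_invmx. Qed.

Lemma adj_unit n (X : 'M[C]_n) : (X^t* \in unitmx) = (X \in unitmx).
Proof. by rewrite map_unitmx unitmx_tr. Qed.

End Adjoint.

Section HermitianSimilarity.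
Variables (C : numClosedFieldType) (N r q : nat) (P : 'I_N -> 'M[C]_r).
Hypotheses (P_proj : block_projectors P) (P_adj : forall k, (P k)^t* = P k).
Variables (A : 'M[C]_r) (B : 'M[C]_(r, q)) (G : 'M[C]_(q, r)).
Hypotheses (ctrlB : controllable P A B) (ctrlG : controllable P (A^t*) (G^t*)).
Let f1 := tail P A B.
Let f2 := tail P (A^t*) (G^t*).
Hypothesis f12 : forall k u v, (f2 u)^t* *m P k *m f1 v = (f1 u)^t* *m P k *m f2 v.

Lemma eq_from_f1 m (X Y : 'M[C]_(r, m)) :
  (forall k u, (f1 u)^t* *m P k *m X = (f1 u)^t* *m P k *m Y) -> X = Y.
Proof.
move=> XY; apply: adj_inj; apply: (controllable_eq P_proj ctrlB) => k u.
by have /(congr1 (fun M : 'M__ => M^t*)) := XY k u; rewrite !adjM P_adj !adjK mulmxA => ->;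
   rewrite mulmxA.
Qed.

(** State space isomorphism: [T] has to send each [P k *m f1 v] to [P k *m f2 v]. The Hankel
    identity [f12] makes this consistent, and its symmetry makes [T] Hermitian. Injectivity comes
    from [ctrlG]. *)
Lemma hermitian_similarity : exists T : 'M[C]_r,
  [/\ T \in unitmx, T^t* = T, forall k, T *m P k = P k *m T,
      T *m A = A^t* *m T & T *m B = G^t*].
Proof.
(* By controllability the columns of the [P k *m f1 v] span the range of [P k]. *)
have /fin_all_exists [c cP] k :
    exists c : seq (word N * 'M_(q, r)), P k = \sum_(v <- c) P k *m f1 v.1 *m v.2.
  apply: (@colcomb_spanning _ _ _ _ (fun v => P k *m f1 v)) => x xP.
  by apply: controllable_tail ctrlB _ _ _ _ => // w; rewrite -mulmxA xP.
(* Replacing [f1] by [f2] in the expansion of [P k] gives the block [k] of [T]. *)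
pose T := \sum_k (\sum_(v <- c k) P k *m f2 v.1 *m v.2) *m P k.
have TPl k : P k *m T = (\sum_(v <- c k) P k *m f2 v.1 *m v.2) *m P k.
  rewrite mulmx_sumr (bigD1 k) //= [X in _ + X]big1 => [|j jk].
    rewrite addr0 mulmxA mulmx_sumr; congr (_ *m _); apply: eq_bigr => v _.
    by rewrite !mulmxA P_proj.1 eqxx.
  rewrite mulmxA mulmx_sumr big1 ?mul0mx // => v _.
  by rewrite !mulmxA P_proj.1 eq_sym (negPf jk) !mul0mx.
have TP k : T *m P k = P k *m T.
  rewrite TPl {1}/T mulmx_suml (bigD1 k) //= [X in _ + X]big1 => [|j jk].
    by rewrite addr0 -mulmxA P_proj.1 eqxx.
  by rewrite -mulmxA P_proj.1 (negPf jk) mulmx0.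
(* [f12] moves [f2] to the left factor, after which the expansion sums back to [P k]; the choice of
   [c] drops out. *)
have f1T k u : (f1 u)^t* *m P k *m T = (f2 u)^t* *m P k.
  rewrite -mulmxA TPl mulmxA mulmx_sumr.
  under eq_bigr do rewrite !mulmxA -f12 -!(mulmxA (_ ^t*)).
  by rewrite -mulmx_sumr -cP -mulmxA P_proj.1 eqxx.
have Tf k v : T *m P k *m f1 v = P k *m f2 v.
  apply: eq_from_f1 => j u; rewrite TP !mulmxA -(mulmxA _ (P j)) P_proj.1.
  case: eqP => [<-|_]; last by rewrite mulmx0 !mul0mx.
  by rewrite f1T f12.
have Tadj : T^t* = T.
  apply: eq_from_f1 => k u; rewrite f1T.
  have /(congr1 (fun M : 'M__ => M^t*)) := Tf k u.
  by rewrite !adjM P_adj mulmxA.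
have Tf' v : T *m f1 v = f2 v.
  have e X : X = \sum_k P k *m X :> 'M_(r, q).
    by rewrite -mulmx_suml P_proj.2 mul1mx.
  by rewrite [f1 v]e [RHS]e mulmx_sumr; apply: eq_bigr => k _; rewrite mulmxA Tf.
exists T; split=> //; last exact: (Tf' [::]).
- rewrite -row_free_unit -kermx_eq0; apply/eqP.
  apply: (controllable_eq P_proj ctrlG) => k w.
  by rewrite mul0mx mul0mx -mulmxA -[tail _ _ _ _]/(f2 w) -Tf !mulmxA mulmx_ker !mul0mx.
- apply: (controllable_eq P_proj ctrlB) => k w.
  have := Tf' (k :: w); rewrite /f1 /f2 /= -/(f1 w) -/(f2 w).
  rewrite !mulmxA => ->; rewrite -(mulmxA _ T) TP -!mulmxA; congr (_ *m _).
  by rewrite !mulmxA -TP Tf.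
Qed.

End HermitianSimilarity.

(* [T] is the similarity between the Cayley-transformed node and its adjoint; the
   matrix [H] of the theorem is [- T / 2]. *)
Lemma cayley_node_stein (C : numClosedFieldType) (r q : nat) (l : C)
    (A R T : 'M[C]_r) (B : 'M[C]_(r, q)) (G : 'M[C]_(q, r)) (D : 'M[C]_q) :
  l * l^* = 1 -> R *m (l%:M - A) = 1%:M -> T^t* = T ->
  let a := - (2%:R * 'i * l) in
  let A1 := a *: R + ('i)%:M in
  T *m A1 = A1^t* *m T -> T *m (R *m B) = (a *: (G *m R))^t* ->
  D + G *m R *m B = (D + G *m R *m B)^t* ->
  let H := - 2%:R^-1 *: T in
  [/\ A^t* *m H *m A = H, D - D^t* = 'i *: (B^t* *m H *m B)
    & G = 'i *: (B^t* *m H *m A)].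
Proof.
move=> ll RA Tadj a A1 TA TB DD H.
pose M := l%:M - A; have MR : M *m R = 1%:M by exact: mulmx1C.
have RM' : M^t* *m R^t* = 1%:M by rewrite -adjM RA adj1.
have M' : M^t* = (l^*)%:M - A^t* by rewrite adjD adjN adj_scalar.
have two0 : 2%:R != 0 :> C by rewrite pnatr_eq0.
have i0 : 2%:R * 'i != 0 :> C by rewrite mulf_neq0 ?neq0Ci.
have a' : a^* = 2%:R * 'i * l^*.
  by rewrite rmorphN !rmorphM /= conjCi rmorph_nat mulrN mulNr opprK.
(* This is [TA] divided by 2i. The other identities follow by cancelling resolvents against [M] and
   [M^t*]. *)
have Eq1 : l *: (T *m R) + l^* *: (R^t* *m T) = T.
  apply: (scalerI i0); rewrite scalerDr !scalerA -a'.
  have -> : 2%:R * 'i * l = - a by rewrite opprK.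
  have := TA; rewrite /A1 adjD adjZ adj_scalar conjCi mulmxDr mulmxDl.
  rewrite -scalemxAr -scalemxAl mul_mx_scalar mul_scalar_mx [(- 'i) *: _]scaleNr => e.
  have -> : a^* *: (R^t* *m T) = a *: (T *m R) + 'i *: T + 'i *: T by rewrite e subrK.
  by rewrite scaleNr addrA addrA addNr add0r -scalerDl mulr_natl mulr2n.
have Eq2 : l^* *: (R^t* *m T *m M) = - (T *m A).
  have := congr1 (mulmx^~ M) Eq1; rewrite /= mulmxDl -!scalemxAl -(mulmxA T) RA mulmx1.
  by move=> e; apply: (addrI (l *: T)); rewrite e /M mulmxBr mul_mx_scalar.
have Eq3 : l *: (M^t* *m T *m R) = - (A^t* *m T).
  have := congr1 (fun X : 'M__ => X^t*) Eq2.
  by rewrite adjZ conjCK adjN !adjM adjK Tadj mulmxA.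
(* Once [R^t*] is cleared, [l^* *: (T *m A)] stands on both sides, and [l * l^* = 1] reduces the
   remaining term to [T]. *)
have ATA : A^t* *m T *m A = T.
  have := congr1 (mulmx (M^t*)) Eq2.
  rewrite -scalemxAr !mulmxA RM' mul1mx mulmxN M' mulmxBl mul_scalar_mx opprB.
  rewrite /M mulmxBr mul_mx_scalar scalerBr scalerA (mulrC _ l) ll scale1r.
  by rewrite mulmxA => /addIr.
have TAR : T *m A *m R = - (l^* *: (R^t* *m T)).
  apply: (canRL (@opprK _)); rewrite -mulNmx -Eq2 -scalemxAl -(mulmxA (_ *m T)) MR.
  by rewrite mulmx1.
have RAT : R^t* *m A^t* *m T = - (l *: (T *m R)).
  have := congr1 (fun X : 'M__ => X^t*) TAR.
  by rewrite adjN adjZ conjCK !adjM adjK Tadj mulmxA.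
have G' : (2%:R * 'i) *: G^t* = - (A^t* *m T *m B).
  rewrite -mulNmx -Eq3 -scalemxAl -!mulmxA TB adjZ a' adjM -scalemxAr mulmxA RM'.
  by rewrite mul1mx scalerA mulrCA ll mulr1.
have defG : (2%:R * 'i) *: G = B^t* *m T *m A.
  have /(congr1 (fun X : 'M__ => X^t*)) := G'.
  rewrite adjZ rmorphM /= rmorph_nat conjCi adjN !adjM !adjK Tadj.
  by rewrite mulrN scaleNr mulmxA => /oppr_inj.
have cst : 'i * - 2%:R^-1 = (2%:R * 'i)^-1 :> C.
  by rewrite invfM invCi !mulrN mulrC.
have defG1 : G = 'i *: (B^t* *m H *m A).
  apply: (scalerI i0); rewrite defG /H -scalemxAr -scalemxAl !scalerA.
  by rewrite cst mulfV // scale1r.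
split=> //; first by rewrite /H -scalemxAr -scalemxAl ATA.
have -> : D - D^t* = B^t* *m R^t* *m G^t* - G *m R *m B.
  apply/eqP; rewrite subr_eq addrAC eq_sym subr_eq eq_sym; apply/eqP.
  by rewrite {1}DD adjD !adjM mulmxA addrC.
(* With [G] and [G^t*] expressed through [T], the two resolvent terms become the summands of [Eq1]
   between [B^t*] and [B]. *)
apply: (scalerI i0); rewrite scalerBr.
have -> : (2%:R * 'i) *: ('i *: (B^t* *m H *m B)) = B^t* *m T *m B.
  by rewrite /H -scalemxAr -scalemxAl !scalerA -mulrA cst mulfV // scale1r.
rewrite scalemxAr G' !scalemxAl defG.
rewrite mulmxN !mulmxA -!(mulmxA (B^t*)) TAR RAT !(mulmxN, mulNmx) !opprK.
by rewrite -mulmxDr -mulmxDl Eq1.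
Qed.

(** * Minimal nodes *)

Section Blocks.
Variables (F : fieldType) (N : nat) (g : 'I_N -> nat).

Definition blocksel k : 'M[F]_(g k, \sum_i g i) := submxcol 1%:M k.

Definition blockproj k : 'M[F]_(\sum_i g i) := (blocksel k)^T *m blocksel k.

Lemma submxcolE m (X : 'M[F]_(\sum_i g i, m)) k : submxcol X k = blocksel k *m X.
Proof. by rewrite submxcol_mul mul1mx. Qed.

Lemma submxrowE m (X : 'M[F]_(m, \sum_i g i)) k : submxrow X k = X *m (blocksel k)^T.
Proof. by rewrite tr_submxcol trmx1 mul_submxrow mulmx1. Qed.

Lemma submxblockE (X : 'M[F]_(\sum_i g i)) j k :
  submxblock X j k = blocksel j *m X *m (blocksel k)^T.
Proof. by rewrite submxblockEh submxcolE submxrowE mulmxA. Qed.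

Lemma mul_blocksel j k : blocksel j *m (blocksel k)^T = submxblock 1%:M j k.
Proof. by rewrite submxblockE mulmx1. Qed.

Lemma submxblock1 k : submxblock (1%:M : 'M[F]_(\sum_i g i)) k k = 1%:M.
Proof. by rewrite -mxdiagZ submxblock_diag. Qed.

Lemma blockproj_projectors : block_projectors blockproj.
Proof.
split=> [j k|].
  rewrite /blockproj mulmxA -(mulmxA _ (blocksel j)) mul_blocksel.
  case: eqP => [->|/eqP jk]; first by rewrite submxblock1 mulmx1.
  suff -> : submxblock (1%:M : 'M[F]_(\sum_i g i)) j k = 0 by rewrite mulmx0 mul0mx.
  by rewrite -mxdiagZ mxblockK (negPf jk).
transitivity (\sum_k submxrow (1%:M : 'M[F]_(\sum_i g i)) k *m submxcol 1%:M k).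
  by apply: eq_bigr => k _; rewrite /blockproj tr_submxcol trmx1.
by rewrite -mul_mxrow_mxcol submxrowK submxcolK mulmx1.
Qed.

Lemma blockproj_tr k : (blockproj k)^T = blockproj k.
Proof. by rewrite trmx_mul trmxK. Qed.

End Blocks.

(** [Q] is the projection onto the quotient by the row space of [K] and [S] a section of it, so
    [Q *m S] is the identity modulo [K] and [n'] is [n] minus the rank of [K]. The data live in
    [Type] so that families over the blocks can be formed. *)
Lemma row_quotient (F : fieldType) m n (K : 'M[F]_(m, n)) :
  {n' : nat & {Q : 'M[F]_(n, n') & {S : 'M[F]_(n', n) |
    [/\ K *m Q = 0, (1%:M - Q *m S <= K)%MS & (n <= n')%N -> K = 0]}}}.
Proof.
have KQ : K *m col_base (cokermx K) = 0.
  apply: (row_free_inj (row_base_free (cokermx K))).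
  by rewrite -mulmxA mulmx_base mulmx_coker mul0mx.
exists (\rank (cokermx K)), (col_base (cokermx K)), (pinvmx (col_base (cokermx K))).
split=> //.
  rewrite submxE -[X in _ *m X]mulmx_base mulmxA mulmxBl mul1mx -mulmxA.
  by rewrite mulVpmx ?col_base_full // mulmx1 subrr mul0mx.
move=> le_n; apply/eqP; rewrite -mxrank_eq0.
by have := rank_leq_col K; move: le_n; rewrite mxrank_coker; lia.
Qed.

(** Invariance under the projectors splits [K] along the blocks, so each block can be divided
    separately. Then [Q k *m S k] differs from the identity only by rows in [K], which are invisible
    to [B] and stay invisible after [A]. *)
Lemma invariant_quotient (F : fieldType) (N q : nat) (g : 'I_N -> nat)
    (A K : 'M[F]_(\sum_i g i)) (B : 'M[F]_(\sum_i g i, q)) :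
  (forall k, (K *m blockproj F g k <= K)%MS) -> (K *m A <= K)%MS -> K *m B = 0 ->
  exists (g' : 'I_N -> nat) (Q : forall k, 'M[F]_(g k, g' k))
         (S : forall k, 'M[F]_(g' k, g k)),
    [/\ forall j k, Q j *m S j *m submxblock A j k *m Q k = submxblock A j k *m Q k,
        forall k, Q k *m S k *m submxcol B k = submxcol B k
      & (forall k, (g k <= g' k)%N) -> K = 0].
Proof.
move=> KP KA KB.
have quo k := row_quotient (K *m (blocksel F g k)^T).
pose g' k := tag (quo k); pose Q k : 'M_(g k, g' k) := tag (tagged (quo k)).
pose S k : 'M_(g' k, g k) := sval (tagged (tagged (quo k))).
have KQ k : K *m (blocksel F g k)^T *m Q k = 0.
  by rewrite /Q; case: (tagged (tagged (quo k))) => ? [].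
have QS k : (1%:M - Q k *m S k <= K *m (blocksel F g k)^T)%MS.
  by rewrite /Q /S; case: (tagged (tagged (quo k))) => ? [].
exists g', Q, S; split=> [j k|k|gg].
- apply/eqP; rewrite eq_sym -subr_eq0 -{1}[submxblock A j k]mul1mx -!mulmxBl.
  have /submxP[X ->] := QS j.
  have /submxP[Y defY] := submx_trans (submxMr A (KP j)) KA.
  apply/eqP; rewrite submxblockE.
  transitivity (X *m (K *m blockproj F g j *m A) *m (blocksel F g k)^T *m Q k).
    by rewrite /blockproj !mulmxA.
  by rewrite defY mulmxA -(mulmxA _ K) -mulmxA KQ mulmx0.
- apply/eqP; rewrite eq_sym -subr_eq0 -{1}[submxcol B k]mul1mx -mulmxBl.
  have /submxP[X ->] := QS k; have /submxP[Y defY] := KP k.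
  apply/eqP; rewrite submxcolE.
  transitivity (X *m (K *m blockproj F g k *m B)); first by rewrite /blockproj !mulmxA.
  by rewrite defY -mulmxA KB !mulmx0.
- apply: (eq_from_proj (blockproj_projectors F g)) => k.
  rewrite mul0mx /blockproj mulmxA (_ : K *m _ = 0) ?mul0mx //.
  by have := gg k; rewrite /g'; case: (quo k) => n' [? [? []]].
Qed.

Definition node_coef (F : fieldType) (N r q : nat) (P : 'I_N -> 'M[F]_r)
    A B (G : 'M[F]_(q, r)) (D : 'M[F]_q) (w : word N) :=
  if w is j :: w' then G *m P j *m tail P A B w' else D.

Section Minimality.
Variables (C : numClosedFieldType) (N q : nat) (g : 'I_N -> nat).
Variables (alpha : gr_node C q g).
Let A := gr_A alpha.
Let B := gr_B alpha.
Let G := gr_C alpha.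
Let P := blockproj C g.

Lemma blockproj_adj k : (P k)^t* = P k.
Proof.
rewrite blockproj_tr /P /blockproj map_mxM -map_trmx.
by rewrite (_ : map_mx _ (blocksel C g k) = blocksel C g k) // /blocksel map_mxsub map_mx1.
Qed.

Lemma gr_tailE j w : gr_tail alpha j w = submxcol (tail P A B w) j.
Proof.
elim: w j => //= k w IHw j.
by rewrite IHw submxblockE !submxcolE /P /blockproj !mulmxA.
Qed.

Lemma transferE w : transfer alpha w = node_coef P A B G (gr_D alpha) w.
Proof.
case: w => //= j w.
by rewrite gr_tailE submxrowE submxcolE /P /blockproj !mulmxA.
Qed.

(** Dividing out an uncontrollable subspace gives another realization; since by minimality none of
    its blocks is smaller, the subspace is zero. *)
Lemma minimal_controllable Psi :
  minimal_gr_realization Psi alpha -> controllable P A B.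
Proof.
move=> [real min] K KP KA KB.
have [g' [Q [S [QA QB]]]] := invariant_quotient KP KA KB; apply.
pose beta := @GRNode C N q g' (\mxblock_(j, k) (S j *m submxblock A j k *m Q k))
  (\mxcol_k (S k *m submxcol B k)) (\mxrow_k (submxrow G k *m Q k)) (gr_D alpha).
apply: (min _ beta) => w; rewrite -real.
have tailE j v : gr_tail alpha j v = Q j *m gr_tail beta j v.
  elim: v j => [|k v IHv] j /=; first by rewrite mxcolK mulmxA QB.
  by rewrite mxblockK IHv !mulmxA QA.
by case: w => //= j w; rewrite mxrowK tailE mulmxA.
Qed.

(** The quotient is taken for the adjoint node, and its maps are carried back by adjunction: [Q] now
    acts on the left and [S] on the right. *)
Lemma minimal_observable Psi :
  minimal_gr_realization Psi alpha -> controllable P (A^t*) (G^t*).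
Proof.
move=> [real min] K KP KA KB.
have [g' [Q [S [QA QB]]]] := invariant_quotient KP KA KB; apply.
pose beta := @GRNode C N q g'
  (\mxblock_(j, k) ((Q j)^t* *m submxblock A j k *m (S k)^t*))
  (\mxcol_k ((Q k)^t* *m submxcol B k)) (\mxrow_k (submxrow G k *m (S k)^t*)) (gr_D alpha).
have adjblock j k : (submxblock (A^t*) j k)^t* = submxblock A k j.
  by apply/matrixP => s t; rewrite !mxE conjCK.
have adjrow k : (submxcol (G^t*) k)^t* = submxrow G k.
  by apply/matrixP => s t; rewrite !mxE conjCK.
apply: (min _ beta) => w; rewrite -real.
have tailE j v : gr_tail beta j v = (Q j)^t* *m gr_tail alpha j v.
  elim: v j => [|k v IHv] j /=; first by rewrite mxcolK.
  rewrite mxblockK IHv !mulmxA; congr (_ *m _).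
  have := congr1 (fun X : 'M__ => X^t*) (QA k j).
  by rewrite !adjM adjblock !mulmxA.
case: w => //= j w; rewrite mxrowK tailE mulmxA; congr (_ *m _).
have := congr1 (fun X : 'M__ => X^t*) (QB j).
by rewrite !adjM adjrow mulmxA.
Qed.

End Minimality.

(** * Values and orders of fractions *)

(* [R] plays the role of a polynomial ring over [C], embedded by [f] in its field
   of fractions [K]; the rings are kept abstract because conversion is very slow in
   the concrete fraction field. *)
Section FractionValue.
Variables (C K : fieldType) (R : idomainType).
Variables (f : {rmorphism R -> K}) (cst : {rmorphism C -> R}).
Hypothesis f_inj : injective f.

Section Value.
Variable ev : {rmorphism R -> C}.
Hypothesis ev_cst : forall c, ev (cst c) = c.

Definition fval (x : K) (v : C) :=
  exists p d, [/\ ev d != 0, x = f p / f d & v = ev p / ev d].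

Lemma ev_neq0 d : ev d != 0 -> f d != 0.
Proof.
apply: contraNneq => d0; have -> : d = 0 by apply: f_inj; rewrite d0 rmorph0.
by rewrite rmorph0.
Qed.

Lemma fval_emb p : fval (f p) (ev p).
Proof. by exists p, 1; rewrite !rmorph1 !divr1 oner_neq0. Qed.

Lemma fval_cst c : fval (f (cst c)) c.
Proof. by rewrite -{2}(ev_cst c); apply: fval_emb. Qed.

Lemma fval0 : fval 0 0.
Proof. by have := fval_emb 0; rewrite !rmorph0. Qed.

Lemma fval1 : fval 1 1.
Proof. by have := fval_emb 1; rewrite !rmorph1. Qed.

Lemma fvalD x y v w : fval x v -> fval y w -> fval (x + y) (v + w).
Proof.
move=> [p [d [d0 -> ->]]] [p' [d' [d'0 -> ->]]].
exists (p * d' + p' * d), (d * d'); split.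
- by rewrite rmorphM mulf_neq0.
- by rewrite addf_div ?ev_neq0 // rmorphD !rmorphM.
- by rewrite addf_div // rmorphD !rmorphM.
Qed.

Lemma fvalM x y v w : fval x v -> fval y w -> fval (x * y) (v * w).
Proof.
move=> [p [d [d0 -> ->]]] [p' [d' [d'0 -> ->]]].
exists (p * p'), (d * d'); split.
- by rewrite rmorphM mulf_neq0.
- by rewrite mulf_div !rmorphM.
- by rewrite mulf_div !rmorphM.
Qed.

Lemma fvalN x v : fval x v -> fval (- x) (- v).
Proof.
move=> h; rewrite -mulN1r -[- v]mulN1r; apply: fvalM h.
by have := fval_emb (-1); rewrite !rmorphN1.
Qed.

Lemma fval_sign m : fval ((-1) ^+ m) ((-1) ^+ m).
Proof. by have := fval_emb ((-1) ^+ m); rewrite !rmorphXn !rmorphN1. Qed.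

Lemma fvalV x v : v != 0 -> fval x v -> fval x^-1 v^-1.
Proof.
move=> v0 [p [d [d0 -> defv]]]; exists d, p; split.
- by apply: contraNneq v0 => p0; rewrite defv p0 mul0r.
- by rewrite invf_div.
- by rewrite defv invf_div.
Qed.

Lemma fval_uniq x v w : fval x v -> fval x w -> v = w.
Proof.
move=> [p [d [d0 -> ->]]] [p' [d' [d'0 /eqP e ->]]].
apply/eqP; rewrite eqr_div //; move: e.
by rewrite eqr_div ?ev_neq0 // -!rmorphM => /eqP/f_inj ->.
Qed.

Lemma fval_sum I (s : seq I) (x : I -> K) v :
  (forall i, fval (x i) (v i)) -> fval (\sum_(i <- s) x i) (\sum_(i <- s) v i).
Proof.
move=> h; elim: s => [|i s IHs]; first by rewrite !big_nil; exact: fval0.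
by rewrite !big_cons; apply: fvalD.
Qed.

Lemma fval_prod I (s : seq I) (x : I -> K) v :
  (forall i, fval (x i) (v i)) -> fval (\prod_(i <- s) x i) (\prod_(i <- s) v i).
Proof.
move=> h; elim: s => [|i s IHs]; first by rewrite !big_nil; exact: fval1.
by rewrite !big_cons; apply: fvalM.
Qed.

Definition mxval a b (X : 'M[K]_(a, b)) (V : 'M[C]_(a, b)) :=
  forall i j, fval (X i j) (V i j).

Lemma mxval_cst a b (V : 'M_(a, b)) : mxval (map_mx (f \o cst) V) V.
Proof. by move=> i j; rewrite mxE; apply: fval_cst. Qed.

Lemma mxvalD a b (X Y : 'M_(a, b)) V W : mxval X V -> mxval Y W -> mxval (X + Y) (V + W).
Proof. by move=> h h' i j; rewrite !mxE; apply: fvalD. Qed.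

Lemma mxvalN a b (X : 'M_(a, b)) V : mxval X V -> mxval (- X) (- V).
Proof. by move=> h i j; rewrite !mxE; apply: fvalN. Qed.

Lemma mxval_sum I (s : seq I) a b (X : I -> 'M_(a, b)) V :
  (forall i, mxval (X i) (V i)) -> mxval (\sum_(i <- s) X i) (\sum_(i <- s) V i).
Proof. by move=> h i j; rewrite !summxE; apply: fval_sum => k; apply: h. Qed.

Lemma mxvalM a b c (X : 'M_(a, b)) (Y : 'M_(b, c)) V W :
  mxval X V -> mxval Y W -> mxval (X *m Y) (V *m W).
Proof. by move=> h h' i j; rewrite !mxE; apply: fval_sum => k; apply: fvalM. Qed.

Lemma mxval_tens a b c d (X : 'M_(a, b)) (Y : 'M_(c, d)) V W :
  mxval X V -> mxval Y W -> mxval (X *t Y) (V *t W).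
Proof. by move=> h h' i j; rewrite !mxE; apply: fvalM. Qed.

Lemma mxval1 a : mxval (1%:M : 'M_a) 1%:M.
Proof. by move=> i j; rewrite !mxE; case: (i == j); [exact: fval1 | exact: fval0]. Qed.

Lemma fval_det a (X : 'M_a) V : mxval X V -> fval (\det X) (\det V).
Proof.
move=> h; rewrite /determinant; apply: fval_sum => s; apply: fvalM; last exact: fval_prod.
exact: fval_sign.
Qed.

Lemma mxval_unit a (X : 'M_a) V : mxval X V -> V \in unitmx -> X \in unitmx.
Proof.
move=> /fval_det h; rewrite !unitmxE !unitfE; apply: contraNneq => e.
by rewrite e in h; rewrite (fval_uniq h fval0).
Qed.

(** Cramer's formula: numerator and denominator are determinants in the entries, and the denominator
    has the non-zero value [\det V]. *)
Lemma mxvalV a (X : 'M_a) V : V \in unitmx -> mxval X V -> mxval (invmx X) (invmx V).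
Proof.
move=> uV h i j; rewrite /invmx uV (mxval_unit h uV) !mxE; apply: fvalM.
  by apply: fvalV; [rewrite -unitfE -unitmxE | exact: fval_det].
rewrite /cofactor; apply: fvalM; first exact: fval_sign.
by apply: fval_det => k l; rewrite !mxE.
Qed.

End Value.

Section Order.
Variable (ev : {rmorphism R -> C}) (sc : {rmorphism R -> {poly R}}).
Hypotheses (ev_cst : forall c, ev (cst c) = c) (sc_inj : injective sc).
Hypothesis sc_coef0 : forall p, (sc p)`_0 = cst (ev p).

(* [sc] stands for the substitution of t X for X, so that [x] = p/d where p vanishes
   to order [m] at 0. *)
Definition order_ge m (x : K) := exists p d u,
  [/\ ev d != 0, x = f p / f d & sc p = u * 'X^m].

Lemma fval_order0 x v : fval ev x v -> order_ge 0 x.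
Proof. by move=> [p [d [d0 -> _]]]; exists p, d, (sc p); rewrite mulr1. Qed.

Lemma order_geD m x y : order_ge m x -> order_ge m y -> order_ge m (x + y).
Proof.
move=> [p [d [u [d0 -> eu]]]] [p' [d' [u' [d'0 -> eu']]]].
exists (p * d' + p' * d), (d * d'), (u * sc d' + u' * sc d); split.
- by rewrite rmorphM mulf_neq0.
- by rewrite addf_div ?(ev_neq0 d0) ?(ev_neq0 d'0) // rmorphD !rmorphM.
- by rewrite rmorphD !rmorphM eu eu' mulrDl mulrAC; congr (_ + _); rewrite mulrAC.
Qed.

Lemma order_ge_sum m I (s : seq I) (x : I -> K) :
  (forall i, order_ge m (x i)) -> order_ge m (\sum_(i <- s) x i).
Proof.
move=> h; elim: s => [|i s IHs]; last by rewrite big_cons; apply: order_geD.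
by rewrite big_nil; exists 0, 1, 0; rewrite !rmorph0 rmorph1 oner_neq0 !mul0r.
Qed.

Lemma order_geX m p u x :
  sc p = u * 'X -> order_ge m x -> order_ge m.+1 (f p * x).
Proof.
move=> scp [p' [d [u' [d0 -> eu]]]]; exists (p * p'), d, (u * u'); split=> //.
  by rewrite rmorphM mulrA.
by rewrite rmorphM eu scp exprS !mulrA; congr (_ * _); rewrite mulrAC.
Qed.

(** A non-zero numerator has a lowest non-zero coefficient after scaling, say in degree [m]; a
    representation of order [m.+1] contradicts it by cross-multiplication. *)
Lemma order_ge_inf x : (forall m, order_ge m x) -> x = 0.
Proof.
move=> h; have [p [d [_ [d0 ex _]]]] := h 0%N.
suff p0 : p = 0 by rewrite ex p0 rmorph0 mul0r.
apply: sc_inj; rewrite rmorph0; apply/eqP; apply: contraTT isT => p0.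
have e : exists m, (sc p)`_m != 0.
  by exists (size (sc p)).-1; rewrite -[_`__]/(lead_coef _) lead_coef_eq0.
case: (ex_minnP e) => m m0 min.
have [p' [d' [u [d'0 ex' eu]]]] := h m.+1.
have /f_inj : f (p * d') = f (p' * d).
  by apply/eqP; rewrite !rmorphM -eqr_div ?(ev_neq0 d0) ?(ev_neq0 d'0) // -ex -ex'.
(* In degree [m] one side is that lowest coefficient times the non-zero constant term of [sc d'],
   while the other side is divisible by ['X^m.+1]. *)
move=> /(congr1 (fun p => (sc p)`_m)).
rewrite !rmorphM eu mulrAC coefMXn ltnSn coefM big_ord_recr big1 /= => [|j _].
  rewrite add0r subnn sc_coef0 => /eqP; rewrite mulf_eq0 (negPf m0) /=.
  by move=> /eqP/(congr1 ev); rewrite ev_cst rmorph0 => /eqP; rewrite (negPf d'0).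
suff -> : (sc p)`_j = 0 by rewrite mul0r.
by apply/eqP; apply: contraTT (ltn_ord j) => /min; rewrite -leqNgt.
Qed.

End Order.
End FractionValue.

(** * Evaluation and expansion of realizations *)

Section Evaluation.
Variables (K : comUnitRingType) (N n r q : nat).

Definition blk a b (X : 'M[K]_(a * n, b * n)) s t : 'M[K]_n :=
  \matrix_(i, j) X (mxtens_index (s, i)) (mxtens_index (t, j)).

Lemma blkE a b (X : 'M[K]_(a * n, b * n)) s t i j :
  blk X s t i j = X (mxtens_index (s, i)) (mxtens_index (t, j)).
Proof. by rewrite mxE. Qed.

Lemma sum_mxtens a (F : 'I_(a * n) -> K) :
  \sum_k F k = \sum_s \sum_i F (mxtens_index (s, i)).
Proof.
rewrite pair_big (reindex (@mxtens_index a n)) /=.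
  by apply: eq_bigr => -[].
by exists (@mxtens_unindex a n) => k _; rewrite (mxtens_indexK, mxtens_unindexK).
Qed.

Lemma blkD a b (X Y : 'M[K]_(a * n, b * n)) s t : blk (X + Y) s t = blk X s t + blk Y s t.
Proof. by apply/matrixP => i j; rewrite !mxE. Qed.

Lemma blk_sum (I : finType) a b (X : I -> 'M[K]_(a * n, b * n)) s t :
  blk (\sum_i X i) s t = \sum_i blk (X i) s t.
Proof.
by apply/matrixP => i j; rewrite !mxE !summxE; apply: eq_bigr => k _; rewrite mxE.
Qed.

Lemma blk_tens1 a b (X : 'M[K]_(a, b)) s t : blk (X *t (1%:M : 'M_n)) s t = (X s t)%:M.
Proof. by apply/matrixP => i j; rewrite mxE tensmxE !mxE mulr_natr. Qed.

Lemma blk_tensM a b c (X : 'M[K]_(a, b)) (Y : 'M_n) (S : 'M_(b * n, c * n)) s t :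
  blk ((X *t Y) *m S) s t = Y *m \sum_u X s u *: blk S u t.
Proof.
apply/matrixP => i j; rewrite !mxE sum_mxtens exchange_big; apply: eq_bigr => k _.
rewrite summxE mulr_sumr; apply: eq_bigr => u _.
by rewrite tensmxE !mxE mulrA (mulrC (X s u)).
Qed.

Variables (P : 'I_N -> 'M[K]_r) (A : 'M[K]_r) (B : 'M[K]_(r, q)).
Variables (G : 'M[K]_(q, r)) (D : 'M[K]_q).

Definition delta (Z : 'I_N -> 'M[K]_n) : 'M_(r * n) := \sum_k P k *t Z k.

(** The factor order [I - A Delta], rather than [I - Delta A], gives the state the equation
    [X = B + A Delta X], which unfolds letter by letter like [tail]. The transfer function is the
    same because [(I - Delta A)^-1 Delta = Delta (I - A Delta)^-1]. *)
Definition pencil Z : 'M_(r * n) := 1%:M - (A *t 1%:M) *m delta Z.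

Definition state Z : 'M_(r * n, q * n) := invmx (pencil Z) *m (B *t 1%:M).

Definition evaluation Z : 'M_(q * n) := D *t 1%:M + (G *t 1%:M) *m delta Z *m state Z.

Lemma tens_delta m (X : 'M_(m, r)) Z :
  (X *t 1%:M) *m delta Z = \sum_k (X *m P k) *t Z k.
Proof.
by rewrite /delta mulmx_sumr; apply: eq_bigr => k _; rewrite tensmx_mul mul1mx.
Qed.

Lemma blk_state Z s t : pencil Z \in unitmx ->
  blk (state Z) s t
    = (B s t)%:M + \sum_k Z k *m \sum_u (A *m P k) s u *: blk (state Z) u t.
Proof.
move=> uZ; have : pencil Z *m state Z = B *t 1%:M by rewrite mulKVmx.
rewrite /pencil mulmxBl mul1mx => /eqP; rewrite subr_eq => /eqP {1}->.
rewrite blkD blk_tens1 tens_delta mulmx_suml blk_sum; congr (_ + _).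
by apply: eq_bigr => k _; rewrite blk_tensM.
Qed.

Lemma blk_evaluation Z s t :
  blk (evaluation Z) s t
    = (D s t)%:M + \sum_k Z k *m \sum_u (G *m P k) s u *: blk (state Z) u t.
Proof.
rewrite blkD blk_tens1 tens_delta mulmx_suml blk_sum; congr (_ + _).
by apply: eq_bigr => k _; rewrite blk_tensM.
Qed.

End Evaluation.

Section Expansion.
Variables (C K : fieldType) (R : idomainType).
Variables (f : {rmorphism R -> K}) (cst : {rmorphism C -> R}).
Variables (ev0 : {rmorphism R -> C}) (sc : {rmorphism R -> {poly R}}).
Hypotheses (f_inj : injective f) (ev_cst : forall c, ev0 (cst c) = c).
Hypotheses (sc_inj : injective sc) (sc_coef0 : forall p, (sc p)`_0 = cst (ev0 p)).
Variables (N n : nat) (x : 'I_N -> 'M[R]_n).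
Hypothesis ev_x : forall k i j, ev0 (x k i j) = 0.
Hypothesis sc_x : forall k i j, exists u, sc (x k i j) = u * 'X.
Let k_ : C -> K := f \o cst.
Let X k : 'M[K]_n := map_mx f (x k).

Let kD : {morph k_ : a b / a + b}. Proof. by move=> a b; rewrite /k_ !rmorphD. Qed.
Let kM : {morph k_ : a b / a * b}. Proof. by move=> a b; rewrite /k_ !rmorphM. Qed.
Let kN : {morph k_ : a / - a}. Proof. by move=> a; rewrite /k_ !rmorphN. Qed.
Let k0 : k_ 0 = 0. Proof. by rewrite /k_ !rmorph0. Qed.
Let k1 : k_ 1 = 1. Proof. by rewrite /k_ !rmorph1. Qed.

Definition regular0 a b (M : 'M[K]_(a, b)) := exists V : 'M[C]_(a, b), mxval f ev0 M V.

(* [M] has the expansion \sum_w g_w X^w up to words of length [m]; stating it through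
   the remainders [Mi] makes products and inverses follow by induction on [m]. *)
Fixpoint expands m (M : 'M[K]_n) (g : fps C N) :=
  regular0 M /\
  if m is m'.+1 then exists2 Mi : 'I_N -> 'M[K]_n,
    M = (k_ (g [::]))%:M + \sum_i X i *m Mi i &
    forall i, expands m' (Mi i) (fun w => g (i :: w))
  else True.

Lemma regular0_X k : regular0 (X k).
Proof. by exists (map_mx ev0 (x k)) => i j; rewrite !mxE; apply: fval_emb. Qed.

Lemma regular0_scalar c : regular0 ((k_ c)%:M : 'M_n).
Proof.
exists c%:M => i j; rewrite !mxE; case: (i == j); first exact: fval_cst.
exact: fval0.
Qed.

Lemma regular0D a b (M M' : 'M[K]_(a, b)) : regular0 M -> regular0 M' -> regular0 (M + M').
Proof. by move=> [V h] [V' h']; exists (V + V'); apply: mxvalD. Qed.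

Lemma regular0M a b c (M : 'M[K]_(a, b)) (M' : 'M_(b, c)) :
  regular0 M -> regular0 M' -> regular0 (M *m M').
Proof. by move=> [V h] [V' h']; exists (V *m V'); apply: mxvalM. Qed.

Lemma expands_regular0 m M g : expands m M g -> regular0 M.
Proof. by case: m => [|m] []. Qed.

Lemma expands_ext m M g g' : g =1 g' -> expands m M g -> expands m M g'.
Proof.
elim: m M g g' => [|m IHm] M g g' gg' //= [rM [Mi defM eMi]].
split=> //; exists Mi; first by rewrite -gg'.
by move=> i; apply: IHm (eMi i) => w; apply: gg'.
Qed.

Lemma expands_pred m M g : expands m.+1 M g -> expands m M g.
Proof.
elim: m M g => [|m IHm] M g [rM [Mi defM eMi]]; split=> //.
by exists Mi => // i; apply: IHm.
Qed.

Lemma expandsD m M M' g g' :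
  expands m M g -> expands m M' g' -> expands m (M + M') (fps_add g g').
Proof.
elim: m M M' g g' => [|m IHm] M M' g g' [rM eM] [rM' eM']; split=> //;
  try exact: regular0D.
case: eM eM' => [Mi -> eMi] [Mi' -> eMi']; exists (fun i => Mi i + Mi' i).
  rewrite {1}/fps_add kD raddfD /= addrACA -big_split; congr (_ + _).
  by apply: eq_bigr => i _; rewrite mulmxDr.
by move=> i; apply: (IHm _ _ _ _ (eMi i) (eMi' i)).
Qed.

Lemma expands_scalar m c : expands m (k_ c)%:M (fps_const c).
Proof.
elim: m c => [|m IHm] c; split=> //; try exact: regular0_scalar.
exists (fun=> (k_ 0)%:M) => [|i].
  by rewrite big1 ?addr0 // => i _; rewrite k0 raddf0 mulmx0.
by apply: expands_ext (IHm 0) => -[].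
Qed.

Lemma expandsZ m c M g : expands m M g -> expands m (k_ c *: M) (fun w => c * g w).
Proof.
elim: m M g => [|m IHm] M g [rM eM]; split=> //;
  try by rewrite -mul_scalar_mx; apply: regular0M => //; exact: regular0_scalar.
case: eM => [Mi -> eMi]; exists (fun i => k_ c *: Mi i) => [|i]; last exact: IHm (eMi i).
rewrite scalerDr scale_scalar_mx -kM scaler_sumr; congr (_ + _).
by apply: eq_bigr => i _; rewrite -scalemxAr.
Qed.

Lemma expands_sum m I (s : seq I) (M : I -> 'M_n) g :
  (forall i, expands m (M i) (g i)) ->
  expands m (\sum_(i <- s) M i) (fun w => \sum_(i <- s) g i w).
Proof.
move=> h; elim: s => [|i s IHs].
  rewrite big_nil; have := expands_scalar m 0; rewrite k0 raddf0.
  by apply: expands_ext => -[|? ?]; rewrite big_nil.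
rewrite big_cons; apply: expands_ext (expandsD (h i) IHs) => w.
by rewrite /fps_add big_cons.
Qed.

Lemma expands_var m k : expands m (X k) (fps_var C k).
Proof.
case: m => [|m]; split=> //; try exact: regular0_X.
exists (fun i => (k_ (i == k)%:R)%:M) => [|i].
  rewrite [fps_var _ _ _]/= k0 raddf0 add0r (bigD1 k) //= eqxx k1 mulmx1.
  rewrite big1 ?addr0 // => i /negPf ->; by rewrite k0 raddf0 mulmx0.
apply: expands_ext (expands_scalar m _) => w.
by rewrite /fps_var eqseq_cons; case: w => [|? ?]; rewrite ?andbT ?andbF.
Qed.

Lemma fps_mul_cons (g g' : fps C N) i w :
  fps_mul g g' (i :: w)
    = g [::] * g' (i :: w) + fps_mul (fun v => g (i :: v)) g' w.
Proof. by rewrite /fps_mul /= big_ord_recl. Qed.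

(** First letters are peeled off the left factor; only the term [g [::]] times [M'] draws them from
    the right factor. This matches [fps_mul_cons]. *)
Lemma expandsM m M M' g g' :
  expands m M g -> expands m M' g' -> expands m (M *m M') (fps_mul g g').
Proof.
elim: m M M' g g' => [|m IHm] M M' g g' eM eM'.
  by split=> //; apply: regular0M; apply: expands_regular0; eassumption.
have rM' := expands_regular0 eM'; have pM' := expands_pred eM'.
split; first by apply: regular0M => //; apply: expands_regular0 eM.
case: eM eM' => [rM [Mi defM eMi]] [_ [Mi' defM' eMi']].
exists (fun i => k_ (g [::]) *: Mi' i + Mi i *m M') => [|i].
  rewrite {1}defM mulmxDl mul_scalar_mx {1}defM' scalerDr scale_scalar_mx mulmx_suml.
  rewrite {1}/fps_mul /= big_ord1 /= kM -addrA; congr (_ + _).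
  rewrite scaler_sumr -big_split; apply: eq_bigr => i _.
  by rewrite mulmxDr mulmxA scalemxAr.
apply: expands_ext (expandsD (expandsZ _ (eMi' i)) (IHm _ _ _ _ (eMi i) pM')) => w.
by rewrite fps_mul_cons.
Qed.

(** All remainders are multiplied by some [X i], which vanishes at 0. The value found here makes
    matrices with non-zero constant term invertible. *)
Lemma mxval_expands m M g : expands m.+1 M g -> mxval f ev0 M (g [::])%:M.
Proof.
move=> [_ [Mi -> eMi]].
have -> : (g [::])%:M = (g [::])%:M + \sum_(k < N) 0 :> 'M[C]_n by rewrite big1_eq addr0.
apply: mxvalD => //.
  move=> i j; rewrite !mxE; case: (i == j); first exact: fval_cst.
  exact: fval0.
apply: mxval_sum => // k; have [V hV] := expands_regular0 (eMi k).
rewrite -(mul0mx _ V); apply: mxvalM => // i j.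
by rewrite !mxE -(ev_x k i j); apply: fval_emb.
Qed.

(** From [M = g_0 + \sum_i X_i M_i] follows [M^-1 = g'_0 - g'_0 \sum_i X_i M_i M^-1], so the
    remainders again involve [M^-1], one level lower; the coefficients of [g'] obey the same
    recursion. *)
Lemma expands_inv m M (g g' : fps C N) : g [::] != 0 -> fps_mul g g' =1 fps_const 1 ->
  (forall m, expands m M g) -> expands m (invmx M) g'.
Proof.
move=> g0 gg' eM.
have gg0 : g [::] * g' [::] = 1 by have := gg' [::]; rewrite /fps_mul big_ord1.
have g'0 : g' [::] = (g [::])^-1.
  by apply: (mulfI g0); rewrite gg0 mulfV.
have V0 : ((g [::])%:M : 'M[C]_n) \in unitmx.
  by rewrite unitmxE det_scalar unitfE expf_neq0.
have vM := mxval_expands (eM 1%N); have uM := mxval_unit f_inj vM V0.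
have rI : regular0 (invmx M) by eexists; apply: mxvalV vM.
elim: m => [|m IHm]; split=> //.
have [_ [Mi defM eMi]] := eM m.+1.
have kk : k_ (g [::]) * k_ (g' [::]) = 1.
  by rewrite -kM gg0 k1.
exists (fun i => k_ (- g' [::]) *: (Mi i *m invmx M)) => [|i].
  have := mulmxV uM; rewrite {1}defM mulmxDl mul_scalar_mx mulmx_suml => e.
  have : k_ (g' [::]) *: (1%:M : 'M_n) = k_ (g' [::]) *: 1%:M by [].
  rewrite -{1}e scalerDr scalerA mulrC kk scale1r scalemx1 => <-.
  rewrite -addrA scaler_sumr -big_split big1 ?addr0 // => i _ /=.
  by rewrite -scalemxAr mulmxA kN scaleNr subrr.
apply: expands_ext (expandsZ _ (expandsM (eMi i) IHm)) => w.
have /eqP := gg' (i :: w); rewrite fps_mul_cons addrC addr_eq0 => /eqP ->.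
by rewrite mulrNN mulrA (mulrC (g' [::])) gg0 mul1r.
Qed.

(** Each peeled letter contributes a factor of order one, and the last remainder is regular at 0. *)
Lemma expands_order m M : expands m M (fun=> 0) -> forall i j, order_ge f ev0 sc m (M i j).
Proof.
elim: m M => [|m IHm] M [[V hV] eM] i j; first exact: fval_order0 (hV i j).
have [Mi -> eMi] := eM; rewrite k0 raddf0 add0r summxE.
apply: order_ge_sum => // k; rewrite mxE; apply: order_ge_sum => // l.
by have [u xu] := sc_x k i l; rewrite mxE; apply: order_geX xu (IHm _ (eMi k) _ _).
Qed.

Lemma expands_uniq M M' g :
  (forall m, expands m M g) -> (forall m, expands m M' g) -> M = M'.
Proof.
move=> eM eM'; apply/eqP; rewrite -subr_eq0; apply/eqP/matrixP => i j.
rewrite [RHS]mxE; apply: (order_ge_inf f_inj ev_cst sc_inj sc_coef0) => m.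
have := expandsD (eM m) (expandsZ (-1) (eM' m)); rewrite kN k1 scaleN1r => e.
apply: expands_order; apply: expands_ext e => w.
by rewrite /fps_add mulN1r subrr.
Qed.

Lemma represents_expands (e : rexpr C N) (g : fps C N) :
  represents e g -> forall m, expands m (reval k_ X e) g.
Proof.
elim: e g => [c|k|e1 IH1 e2 IH2|e1 IH1 e2 IH2|e1 IH1] g /=.
- move=> eg m; apply: expands_ext (expands_scalar m c) => w; exact/esym.
- move=> eg m; apply: expands_ext (expands_var m k) => w; exact/esym.
- move=> [g1 [g2 [r1 r2 eg]]] m.
  by apply: expands_ext (expandsD (IH1 _ r1 m) (IH2 _ r2 m)) => w; exact/esym.
- move=> [g1 [g2 [r1 r2 eg]]] m.
  by apply: expands_ext (expandsM (IH1 _ r1 m) (IH2 _ r2 m)) => w; exact/esym.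
- by move=> [g1 [r1 g10 g1g _]] m; apply: expands_inv g1g (IH1 _ r1).
Qed.

Section RealizationExpansion.
Variables (r q : nat) (P : 'I_N -> 'M[C]_r) (A : 'M[C]_r) (B : 'M[C]_(r, q)).
Variables (G : 'M[C]_(q, r)) (D : 'M[C]_q).
Let Pk k := map_mx k_ (P k).
Let Ak := map_mx k_ A.
Let Bk := map_mx k_ B.
Let Gk := map_mx k_ G.
Let Dk := map_mx k_ D.

Section AtPoint.
Variables (ev : {rmorphism R -> C}) (Z : 'I_N -> 'M[C]_n).
Hypotheses (evC : forall c, ev (cst c) = c) (ev_x' : forall k i j, ev (x k i j) = Z k i j).

Lemma mxval_delta : mxval f ev (delta Pk X) (delta P Z).
Proof.
apply: (mxval_sum f_inj) => k; apply: mxval_tens; first exact (mxval_cst f evC _).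
by move=> i j; rewrite mxE -ev_x'; apply: fval_emb.
Qed.

Lemma mxval_pencil : mxval f ev (pencil Pk Ak X) (pencil P A Z).
Proof.
apply: (mxvalD f_inj); first exact: mxval1.
apply: mxvalN; apply: (mxvalM f_inj); last exact: mxval_delta.
by apply: mxval_tens; [exact (mxval_cst f evC _) | exact: mxval1].
Qed.

Lemma mxval_state : pencil P A Z \in unitmx ->
  mxval f ev (state Pk Ak Bk X) (state P A B Z).
Proof.
move=> uZ; apply: (mxvalM f_inj); first by apply: (mxvalV f_inj) => //; exact: mxval_pencil.
by apply: mxval_tens; [exact (mxval_cst f evC _) | exact: mxval1].
Qed.

Lemma mxval_evaluation : pencil P A Z \in unitmx ->
  mxval f ev (evaluation Pk Ak Bk Gk Dk X) (evaluation P A B G D Z).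
Proof.
move=> uZ; apply: (mxvalD f_inj).
  by apply: mxval_tens; [exact (mxval_cst f evC _) | exact: mxval1].
apply: (mxvalM f_inj); last exact: mxval_state.
apply: (mxvalM f_inj); last exact: mxval_delta.
by apply: mxval_tens; [exact (mxval_cst f evC _) | exact: mxval1].
Qed.

End AtPoint.

Let Z0 : 'I_N -> 'M[C]_n := fun=> 0.

Lemma pencil0_unit : pencil P A Z0 \in unitmx.
Proof.
rewrite /pencil /delta big1 ?mulmx0 ?subr0 ?unitmx1 // => k _.
by rewrite tensmx0.
Qed.

Lemma ev_x0 k i j : ev0 (x k i j) = Z0 k i j. Proof. by rewrite ev_x mxE. Qed.

Lemma map_coef m (Y : 'M[C]_(m, r)) k s u :
  (map_mx k_ Y *m Pk k) s u = k_ ((Y *m P k) s u).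
Proof. by rewrite /Pk -(map_mxM (f \o cst)) mxE. Qed.

(** [blk_state] is already an expansion step: the remainder at the letter [k] is a combination of
    blocks of the same state, with coefficients from [A *m P k]. *)
Lemma expands_state m s t :
  expands m (blk (state Pk Ak Bk X) s t) (fun w => tail P A B w s t).
Proof.
have rS s' t' : regular0 (blk (state Pk Ak Bk X) s' t').
  exists (blk (state P A B Z0) s' t') => i j; rewrite !blkE.
  exact: (mxval_state ev_cst ev_x0 pencil0_unit).
have uP := mxval_unit f_inj (mxval_pencil ev_cst ev_x0) pencil0_unit.
elim: m s t => [|m IHm] s t; split=> //.
exists (fun k => \sum_u (Ak *m Pk k) s u *: blk (state Pk Ak Bk X) u t) => [|k].
  by rewrite {1}blk_state // mxE.
under eq_bigr do rewrite map_coef.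
by apply: expands_ext (expands_sum _ (fun u => expandsZ _ (IHm u t))) => w /=; rewrite mxE.
Qed.

Lemma expands_evaluation m s t :
  expands m (blk (evaluation Pk Ak Bk Gk Dk X) s t)
    (fun w => node_coef P A B G D w s t).
Proof.
have rS : regular0 (blk (evaluation Pk Ak Bk Gk Dk X) s t).
  exists (blk (evaluation P A B G D Z0) s t) => i j; rewrite !blkE.
  exact: (mxval_evaluation ev_cst ev_x0 pencil0_unit).
case: m => [|m]; split=> //.
exists (fun k => \sum_u (Gk *m Pk k) s u *: blk (state Pk Ak Bk X) u t) => [|k].
  by rewrite blk_evaluation mxE.
under eq_bigr do rewrite map_coef.
apply: expands_ext (expands_sum _ (fun u => expandsZ _ (expands_state m u t))) => w /=.
by rewrite mxE.
Qed.

Lemma represents_evaluation (e : rexpr C N) s t :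
  represents e (fun w => node_coef P A B G D w s t) ->
  reval k_ X e = blk (evaluation Pk Ak Bk Gk Dk X) s t.
Proof.
move=> re; apply: expands_uniq (represents_expands re) _ => m.
exact: expands_evaluation.
Qed.

End RealizationExpansion.
End Expansion.

(** * The abstract results in the polynomial ring of matrix entries *)

Section ConcreteFractions.
Variables (C : fieldType) (N n : nat).
Notation MP := {mpoly C[#|entry N n|]}.
Let Z0 : 'I_N -> 'M[C]_n := fun=> 0.

Definition frac : {rmorphism MP -> ratfun C N n} := (@tofrac MP : {rmorphism MP -> {fraction MP}}).
Definition constants : {rmorphism C -> MP} := @mpolyC _ C.
Definition value_at (Z : 'I_N -> 'M[C]_n) : {rmorphism MP -> C} := meval (coords Z).
Definition scaling : {rmorphism MP -> {poly MP}} :=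
  mmap (polyC \o @mpolyC _ C) (fun i => ('X_i)%:P * 'X).
Definition variables k : 'M[MP]_n := \matrix_(i, j) 'X_(enum_rank ((k, i, j) : entry N n)).

Lemma frac_inj : injective frac.
Proof. by move=> p p' /eqP; rewrite tofrac_eq => /eqP. Qed.

Lemma value_at_constants Z c : value_at Z (constants c) = c.
Proof. exact: mevalC. Qed.

Lemma value_at_variables Z k i j : value_at Z (variables k i j) = Z k i j.
Proof. by rewrite mxE [LHS]mevalXU /coords enum_rankK. Qed.

Lemma scaling_variables k i j : exists u, scaling (variables k i j) = u * 'X.
Proof. by eexists; rewrite mxE [LHS]mmapX mmap1U. Qed.

Lemma scaling_coef0 p : (scaling p)`_0 = constants (value_at Z0 p).
Proof.
rewrite -horner_coef0 /= /mmap horner_sum mevalE raddf_sum /=.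
apply: eq_bigr => m _; rewrite hornerM /= hornerC mpolyCM; congr (_ * _).
rewrite /mmap1 horner_prod rmorph_prod; apply: eq_bigr => i _ /=.
rewrite horner_exp hornerM hornerX mulr0 rmorphXn /=; congr (_ ^+ _).
by rewrite /coords; case: (enum_val i) => -[? ?] ?; rewrite mxE mpolyC0.
Qed.

(** Setting the scaling parameter to 1 undoes the scaling; hence its injectivity. *)
Lemma scaling_horner1 p : (scaling p).[1] = p.
Proof.
rewrite /= /mmap horner_sum [RHS]mpolyE; apply: eq_bigr => m _.
rewrite hornerM /= hornerC mul_mpolyC; congr (_ *: _).
rewrite -mmap1_id /mmap1 horner_prod; apply: eq_bigr => i _.
by rewrite horner_exp hornerM hornerX mulr1 hornerC.
Qed.

Lemma scaling_inj : injective scaling.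
Proof.
by move=> p p' e; rewrite -(scaling_horner1 p) e (scaling_horner1 p').
Qed.

Lemma generic_mxE : generic_mx C n = (fun k : 'I_N => map_mx frac (variables k)).
Proof. by apply/funext => k; apply/matrixP => i j; rewrite !mxE. Qed.

Lemma ratfun_valueE x Z v : @ratfun_value C N n x Z v = fval frac (value_at Z) x v.
Proof. by []. Qed.

(** Translates indices of block matrices into indices of Kronecker products. *)
Definition tidx q (s : 'I_(\sum_(a < q) n)) : 'I_(q * n) :=
  mxtens_index (tagnat.sig1 s, tagnat.sig2 s).

(** The identity with the realization holds at generic matrices and is then specialized to [Z]; so
    the power series is defined wherever the pencil is invertible. *)
Lemma rational_mxfun_value (r q : nat) P A B G D (E : 'I_q -> 'I_q -> rexpr C N) Z s t :
  (forall a b, represents (E a b) (fun w => @node_coef C N r q P A B G D w a b)) ->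
  pencil P A Z \in unitmx ->
  @ratfun_value C N n (rational_mxfun n E s t) Z (evaluation P A B G D Z (tidx s) (tidx t)).
Proof.
move=> rE uZ; rewrite mxE generic_mxE ratfun_valueE /tidx.
move: (tagnat.sig1 s) (tagnat.sig2 s) (tagnat.sig1 t) (tagnat.sig2 t) => a i b j.
have Z0_variables k i' j' : value_at Z0 (variables k i' j') = 0.
  by rewrite value_at_variables mxE.
have e := represents_evaluation frac_inj (value_at_constants Z0) scaling_inj scaling_coef0
  Z0_variables scaling_variables (rE a b).
rewrite [reval _ _ _]e blkE.
exact: (mxval_evaluation frac_inj _ _ _ (value_at_constants Z) (value_at_variables Z) uZ).
Qed.

End ConcreteFractions.

(** * Walks spelling a word *)

(** [M] strictly lowers the weight [mu], hence is nilpotent. In the proof, a kernel vector satisfies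
    [X = X *m M^T] and vanishes by induction on the weight. *)
Lemma unit_sub_triangular (K : fieldType) m (mu : 'I_m -> nat) (M : 'M[K]_m) :
  (forall i j, M i j != 0 -> (mu j < mu i)%N) -> 1%:M - M \in unitmx.
Proof.
move=> Mmu; rewrite -unitmx_tr -row_free_unit -kermx_eq0; apply/eqP.
have := mulmx_ker (1%:M - M)^T; move: (kermx _) => X.
rewrite linearB /= trmx1 mulmxBr mulmx1 => /eqP; rewrite subr_eq0 => /eqP XM.
suff X0 k i j : (mu j < k)%N -> X i j = 0.
  by apply/matrixP => i j; rewrite (X0 (mu j).+1) // mxE.
elim: k i j => // k IHk i j jk; rewrite XM mxE big1 // => l _; rewrite mxE.
have [->|/Mmu lj] := eqVneq (M j l) 0; first by rewrite mulr0.
by rewrite IHk ?mul0r //; apply: leq_trans lj _; rewrite -ltnS.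
Qed.

Lemma unit_pencil_triangular (K : fieldType) (N n r : nat) (mu : 'I_n -> nat)
    (P : 'I_N -> 'M[K]_r) A (Z : 'I_N -> 'M_n) :
  (forall k i j, Z k i j != 0 -> (mu j < mu i)%N) -> pencil P A Z \in unitmx.
Proof.
move=> Zmu; apply: (@unit_sub_triangular _ _ (fun u => mu (mxtens_unindex u).2)) => u v.
rewrite tens_delta summxE; apply: contraNT => uv; apply/eqP; rewrite big1 // => k _.
rewrite mxE; have [->|/Zmu] := eqVneq (Z k (mxtens_unindex u).2 (mxtens_unindex v).2) 0.
  by rewrite mulr0.
by rewrite (negPf uv).
Qed.

Section WordPaths.
Variables (K : fieldType) (N n r q : nat).
Variables (P : 'I_N -> 'M[K]_r) (A : 'M[K]_r) (B : 'M[K]_(r, q)).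
Variables (G : 'M[K]_(q, r)) (D : 'M[K]_q) (Z : 'I_N -> 'M[K]_n).
Hypothesis uZ : pencil P A Z \in unitmx.

(* From [i] the matrices [Z k] allow only one walk, spelling [w] and ending in [j]. *)
Fixpoint path_to (i : 'I_n) (w : word N) (j : 'I_n) : Prop :=
  if w is k :: w' then i <> j /\ exists2 i',
    forall k' j', Z k' i j' = ((k' == k) && (j' == i'))%:R & path_to i' w' j
  else i = j /\ forall k j', Z k i j' = 0.

(** Since the walk is forced, each use of [blk_state] leaves a single summand. *)
Lemma path_state i w j s t :
  path_to i w j -> blk (state P A B Z) s t i j = tail P A B w s t.
Proof.
elim: w i s => [|k w IHw] i s [ij].
  move=> Zi; rewrite blk_state // mxE summxE big1 => [|k _].
    by rewrite mxE ij eqxx addr0.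
  by rewrite mxE big1 // => l _; rewrite Zi mul0r.
move=> [i' Zi pi']; rewrite blk_state // mxE mxE (introF eqP ij) add0r summxE.
rewrite (bigD1 k) //= [X in _ + X]big1 => [|k' kk']; last first.
  by rewrite mxE big1 // => l _; rewrite Zi (negPf kk') mul0r.
rewrite addr0 [LHS]mxE (bigD1 i') //= [X in _ + X]big1 => [|l li]; last first.
  by rewrite Zi (negPf li) andbF mul0r.
rewrite Zi !eqxx mul1r addr0 summxE mxE; apply: eq_bigr => u _.
by rewrite mxE IHw.
Qed.

Lemma path_evaluation i w j s t :
  path_to i w j -> blk (evaluation P A B G D Z) s t i j = node_coef P A B G D w s t.
Proof.
case: w => [|k w] [ij].
  move=> Zi; rewrite blk_evaluation mxE summxE big1 => [|k _].
    by rewrite mxE ij eqxx addr0.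
  by rewrite mxE big1 // => l _; rewrite Zi mul0r.
move=> [i' Zi pi']; rewrite blk_evaluation mxE mxE (introF eqP ij) add0r summxE.
rewrite (bigD1 k) //= [X in _ + X]big1 => [|k' kk']; last first.
  by rewrite mxE big1 // => l _; rewrite Zi (negPf kk') mul0r.
rewrite addr0 [LHS]mxE (bigD1 i') //= [X in _ + X]big1 => [|l li]; last first.
  by rewrite Zi (negPf li) andbF mul0r.
rewrite Zi !eqxx mul1r addr0 summxE mxE; apply: eq_bigr => u _.
by rewrite mxE (path_state _ _ pi').
Qed.

End WordPaths.

Section WordShift.
Variables (C : numClosedFieldType) (N : nat).

(** One basis vector per position in [w]; [ohead (drop i w)] is the letter at position [i], written
    without a default letter. *)
Definition word_shift (w : word N) (k : 'I_N) : 'M[C]_((size w).+1) :=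
  \matrix_(i, j) ((j == i.+1 :> nat) && (ohead (drop i w) == Some k))%:R.

Lemma path_word_shift w : path_to (word_shift w) ord0 w ord_max.
Proof.
suff h m (i : 'I_((size w).+1)) : (size w - i = m)%N ->
  path_to (word_shift w) i (drop i w) ord_max by have := h _ ord0 erefl; rewrite drop0.
elim: m i => [|m IHm] i e.
  have iw : i = size w :> nat by have := ltn_ord i; lia.
  rewrite drop_oversize ?iw //=; split=> [|k j]; first exact: val_inj.
  by rewrite mxE drop_oversize ?iw ?andbF.
have iw : (i < size w)%N by lia.
case dw : (drop i w) => [|k w'].
  by have := size_drop i w; rewrite dw /=; lia.
split; first by move=> /(congr1 val) /= ?; lia.
have lti : (i.+1 < (size w).+1)%N by [].
exists (Ordinal lti) => [k' j|].
  by rewrite mxE dw /= andbC (inj_eq Some_inj) (eq_sym k) -val_eqE.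
have -> : w' = drop (Ordinal lti) w by rewrite /= -addn1 addnC -drop_drop dw /= drop0.
by apply: IHm => /=; lia.
Qed.

(** Adjoints reverse the arrows, so the walk runs backwards and spells the reversed word. *)
Lemma path_word_shift_adj w :
  path_to (fun k => (word_shift w k)^t*) ord_max (rev w) ord0.
Proof.
suff h m (i : 'I_((size w).+1)) : i = m :> nat ->
  path_to (fun k => (word_shift w k)^t*) i (rev (take i w)) ord0.
  by have := h _ ord_max erefl; rewrite take_size.
elim: m i => [|m IHm] i e.
  rewrite e take0 /=; split=> [|k j]; first exact: val_inj.
  by rewrite !mxE e /= rmorph0.
have mw : (m < size w)%N by rewrite -ltnS -e.
case dw : (drop m w) => [|k w'].
  by have := size_drop m w; rewrite dw /=; lia.
have -> : take i w = rcons (take m w) k.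
  rewrite e -addn1 takeD dw /= take0; exact: cats1.
rewrite rev_rcons /=; split; first by move=> /(congr1 val) /=; rewrite e.
have ltm : (m < (size w).+1)%N by rewrite ltnS ltnW.
exists (Ordinal ltm) => [k' j|]; last exact: (IHm (Ordinal ltm)).
rewrite !mxE rmorph_nat e eqSS -(inj_eq val_inj j) /= [m == _]eq_sym.
case: (eqVneq (j : nat) m) => [->|_]; last by rewrite !andbF.
by rewrite dw andbT (inj_eq Some_inj) (eq_sym k).
Qed.

Lemma word_shift_increasing w k i j : word_shift w k i j != 0 -> (size w - j < size w - i)%N.
Proof.
rewrite mxE; case: (eqVneq (j : nat) i.+1) => [e _|_]; last by rewrite eqxx.
by have := ltn_ord j; lia.
Qed.

Lemma word_shift_adj_decreasing w k i j : (word_shift w k)^t* i j != 0 -> (j < i)%N.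
Proof.
rewrite !mxE; case: (eqVneq (i : nat) j.+1) => [-> _|_]; first exact: ltnSn.
by rewrite conjC0 eqxx.
Qed.

End WordShift.

(** * The Cayley transform of a node *)

Section Delta.
Variables (K : fieldType) (N n r : nat) (P : 'I_N -> 'M[K]_r).
Hypothesis P_proj : block_projectors P.
Implicit Type S T : 'I_N -> 'M[K]_n.

Lemma deltaM S T : delta P S *m delta P T = delta P (fun k => S k *m T k).
Proof.
rewrite /delta mulmx_suml; apply: eq_bigr => j _; rewrite mulmx_sumr (bigD1 j) //=.
rewrite [X in _ + X]big1 => [|k kj].
  by rewrite addr0 tensmx_mul P_proj.1 eqxx.
by rewrite tensmx_mul P_proj.1 eq_sym (negPf kj) tens0mx.
Qed.

Lemma tensmxDr m p a b (X : 'M[K]_(m, p)) (Y Y' : 'M[K]_(a, b)) :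
  X *t (Y + Y') = X *t Y + X *t Y'.
Proof. by apply/matrixP => i j; rewrite !mxE mulrDr. Qed.

Lemma tensmxDl m p a b (X X' : 'M[K]_(m, p)) (Y : 'M[K]_(a, b)) :
  (X + X') *t Y = X *t Y + X' *t Y.
Proof. by apply/matrixP => i j; rewrite !mxE mulrDl. Qed.

Lemma tensmxZl m p a b c (X : 'M[K]_(m, p)) (Y : 'M[K]_(a, b)) :
  (c *: X) *t Y = c *: (X *t Y).
Proof. by apply/matrixP => i j; rewrite !mxE mulrA. Qed.

Lemma tensmxZr m p a b c (X : 'M[K]_(m, p)) (Y : 'M[K]_(a, b)) :
  X *t (c *: Y) = c *: (X *t Y).
Proof. by apply/matrixP => i j; rewrite !mxE mulrCA. Qed.

Lemma tensmx11 m a : (1%:M : 'M[K]_m) *t (1%:M : 'M_a) = 1%:M.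
Proof.
apply/matrixP => u v; case: (mxtens_indexP u) => s i; case: (mxtens_indexP v) => t j.
rewrite tensmxE !mxE -natrM mulnb; congr (_%:R : K); congr nat_of_bool.
by rewrite (inj_eq (can_inj (@mxtens_indexK _ _))) xpair_eqE.
Qed.

Lemma delta1 : delta P (fun=> 1%:M : 'M_n) = 1%:M.
Proof.
rewrite -tensmx11 -P_proj.2 /delta.
by elim/big_rec2: _ => [|k x y _ ->]; rewrite ?tens0mx // tensmxDl.
Qed.

Lemma deltaD S T : delta P (fun k => S k + T k) = delta P S + delta P T.
Proof. by rewrite /delta -big_split; apply: eq_bigr => k _; rewrite tensmxDr. Qed.

Lemma deltaZ c S : delta P (fun k => c *: S k) = c *: delta P S.
Proof. by rewrite /delta scaler_sumr; apply: eq_bigr => k _; rewrite tensmxZr. Qed.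

End Delta.

Section Cayley.
Variables (C : numClosedFieldType) (N n r q : nat) (P : 'I_N -> 'M[C]_r).
Hypothesis P_proj : block_projectors P.
Variables (A R : 'M[C]_r) (B : 'M[C]_(r, q)) (G : 'M[C]_(q, r)) (D : 'M[C]_q) (l : C).
Hypotheses (ll : l * l^* = 1) (RA : R *m (l%:M - A) = 1%:M).
Let a := - (2%:R * 'i * l).
(** Clearing the denominator of the Cayley transform turns the pencil into
    [l(1 + i Delta(S)) - A(1 - i Delta(S))], which is [(l - A)(1 - cayA Delta(S))] with
    [cayA = -i R (l + A)]. *)
Definition cayA := a *: R + ('i)%:M.
Definition cayB := R *m B.
Definition cayC := a *: (G *m R).
Definition cayD := D + G *m R *m B.

Variable S : 'I_N -> 'M[C]_n.
Hypothesis uS : forall k, 1%:M + 'i *: S k \in unitmx.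
Definition cayley k := l^* *: ((1%:M - 'i *: S k) *m invmx (1%:M + 'i *: S k)).

Hypothesis uP : pencil P cayA S \in unitmx.

Let At : 'M_(r * n) := A *t 1%:M.
Let Rt : 'M_(r * n) := R *t 1%:M.
Let E := l *: (1%:M + 'i *: delta P S).

Let delta_cayley : delta P cayley *m E = 1%:M - 'i *: delta P S.
Proof.
have e c : 1%:M + c *: delta P S = delta P (fun k => 1%:M + c *: S k).
  by rewrite deltaD deltaZ (delta1 _ P_proj).
rewrite /E -scaleNr !e -deltaZ (deltaM P_proj); congr delta; apply/funext => k.
rewrite /cayley -scalemxAl -scalemxAr scalerA mulrC ll scale1r.
by rewrite -mulmxA mulVmx // mulmx1 scaleNr.
Qed.

Let RtA : Rt *m (l%:M - At) = 1%:M.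
Proof.
have -> : l%:M - At = (l%:M - A) *t 1%:M.
  rewrite tensmxDl -(scalemx1 r l) -[- A]scaleN1r !tensmxZl tensmx11 scaleN1r.
  by rewrite scalemx1.
by rewrite tensmx_mul RA mulmx1 tensmx11.
Qed.

Lemma pencil_cayleyE :
  pencil P A cayley *m E = (l%:M - At) *m pencil P cayA S.
Proof.
have MR : (l%:M - At) *m Rt = 1%:M by exact: mulmx1C RtA.
have key : (l%:M - At) *m (cayA *t 1%:M) = - ('i * l) *: 1%:M - 'i *: At.
  rewrite /cayA -(scalemx1 r 'i) tensmxDl !tensmxZl tensmx11 mulmxDr -!scalemxAr MR mulmx1.
  rewrite -(scalemx1 _ l) scalerBr scalerA addrA -scalerDl /a; congr (_ *: _ - _).
  by rewrite -mulrA mulr_natl mulr2n opprD subrK.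
rewrite /pencil mulmxBl mul1mx -/At -mulmxA delta_cayley.
rewrite mulmxBr mulmx1 mulmxBr mulmx1 mulmxA key mulmxBl -!scalemxAl mul1mx -scalemxAr.
rewrite scaleNr opprD !opprK opprB /E scalerDr scalemx1 scalerA (mulrC l).
by rewrite opprK addrACA; congr (_ + _); rewrite addrC.
Qed.

Lemma pencil_cayley_unit : pencil P A cayley \in unitmx.
Proof.
have : pencil P A cayley *m E \in unitmx.
  by rewrite pencil_cayleyE unitmx_mul uP (mulmx1_unit RtA).2.
by rewrite unitmx_mul => /andP[].
Qed.

(** The factor [E] clears the denominators: it carries the new state to the old one and turns
    [delta P cayley] into [1 - i Delta(S)]. *)
Lemma evaluation_cayley :
  evaluation P A B G D cayley = evaluation P cayA cayB cayC cayD S.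
Proof.
have MR : (l%:M - At) *m Rt = 1%:M by exact: mulmx1C RtA.
have st : state P A B cayley = E *m state P cayA cayB S.
  apply: (can_inj (mulKmx pencil_cayley_unit)).
  rewrite mulKVmx ?pencil_cayley_unit // mulmxA pencil_cayleyE -mulmxA mulKVmx //.
  rewrite /cayB -[1%:M in RHS](mulmx1 (1%:M : 'M_n)) -tensmx_mul mulmxA MR mul1mx //.
(* The pencil cancels against the new state and leaves the constant [G R B]; the remaining term
   supplies [cayC]. *)
have defG : 1%:M - 'i *: delta P S = pencil P cayA S + a *: (Rt *m delta P S).
  rewrite /pencil /cayA -(scalemx1 r 'i) tensmxDl !tensmxZl tensmx11 mulmxDl -!scalemxAl mul1mx.
  by rewrite opprD addrA addrAC subrK.
rewrite /evaluation st -(mulmxA (G *t _)) (mulmxA (delta _ _)) delta_cayley defG.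
rewrite mulmxDl mulmxDr mulKVmx // addrA /cayD tensmxDl; congr (_ + _ + _).
  rewrite tensmx_mul mulmx1 /cayB; congr (_ *t _); exact: mulmxA.
rewrite /cayC tensmxZl -!scalemxAl -scalemxAr; congr (_ *: _).
by rewrite !mulmxA tensmx_mul mulmx1.
Qed.

(** For Hermitian [S k] the factors [1 - iS] and [1 + iS] are adjoint to each other and commute, and
    [l] is unimodular. *)
Lemma cayley_unitary k : (S k)^t* = S k -> cayley k \is unitarymx.
Proof.
move=> Sk; pose X := 1%:M + 'i *: S k; pose Y := 1%:M - 'i *: S k.
apply/unitarymxP; rewrite /cayley -/X -/Y.
have XY : X^t* = Y by rewrite adjD adj1 adjZ conjCi Sk scaleNr.
have YX : Y^t* = X by rewrite -XY adjK.
have uY : Y \in unitmx by rewrite -XY adj_unit uS.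
have comm : X *m Y = Y *m X.
  by rewrite /X /Y mulmxBr mulmx1 [RHS]mulmxBl mul1mx mulmxDl mulmxDr mul1mx mulmx1.
rewrite adjZ conjCK adjM adj_inv XY YX -scalemxAl -scalemxAr scalerA mulrC ll scale1r.
have -> : invmx Y *m X = X *m invmx Y.
  by apply: (can_inj (mulKmx uY)); rewrite mulKVmx // mulmxA -comm mulmxK.
by rewrite mulmxA mulmxKV ?uS // mulmxV.
Qed.

End Cayley.

(** * Polynomial continuation of Hermitian symmetry *)

Lemma poly_eq0_inj (C : idomainType) (u : nat -> C) (p : {poly C}) :
  injective u -> (forall m, p.[u m] = 0) -> p = 0.
Proof.
move=> u_inj pu; apply/eqP; apply: contraTT isT => p0.
pose rs := [seq u m | m <- iota 0 (size p)].
have rsp : all (root p) rs by apply/allP => _ /mapP[m _ ->]; rewrite /root pu.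
have rsu : uniq rs by rewrite map_inj_uniq ?iota_uniq.
by have := max_poly_roots p0 rsp rsu; rewrite size_map size_iota ltnn.
Qed.

Section HermitianContinuation.
Variables (C : numClosedFieldType) (N n r q : nat) (P : 'I_N -> 'M[C]_r).
Variables (A : 'M[C]_r) (B : 'M[C]_(r, q)) (G : 'M[C]_(q, r)) (D : 'M[C]_q).
Hypothesis herm : forall S : 'I_N -> 'M[C]_n, (forall k, (S k)^t* = S k) ->
  (forall k, 1%:M + 'i *: S k \in unitmx) -> pencil P A S \in unitmx ->
  (evaluation P A B G D S)^t* = evaluation P A B G D S.

Variables S1 S2 : 'I_N -> 'M[C]_n.
Hypotheses (S1h : forall k, (S1 k)^t* = S1 k) (S2h : forall k, (S2 k)^t* = S2 k).
Let S t k := S1 k + t *: S2 k.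
Let cp a b (M : 'M[C]_(a, b)) : 'M[{poly C}]_(a, b) := map_mx polyC M.
Let Sp k := cp (S1 k) + 'X *: cp (S2 k).
Let hv t a b (M : 'M[{poly C}]_(a, b)) := map_mx (horner_eval t) M.

Let hv_cp t a b (M : 'M[C]_(a, b)) : hv t (cp M) = M.
Proof. by apply/matrixP => i j; rewrite !mxE /horner_eval hornerC. Qed.

Let hv_Sp t k : hv t (Sp k) = S t k.
Proof. by apply/matrixP => i j; rewrite !mxE /horner_eval hornerD hornerM hornerX !hornerC. Qed.

Let hv_tens t a b c d (X : 'M[C]_(a, b)) (Y : 'M_(c, d)) : hv t (cp X *t Y) = X *t hv t Y.
Proof. by rewrite [LHS]map_mxT -/(hv _ _) hv_cp. Qed.

Let dp := delta (fun k => cp (P k)) Sp.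
Let pp : 'M_(r * n) := 1%:M - (cp A *t 1%:M) *m dp.
Let d := \det pp.
(** The numerator of the evaluation over the common denominator [d], by the adjugate formula. *)
Let Np : 'M_(q * n) := d *: (cp D *t 1%:M) + (cp G *t 1%:M) *m dp *m (\adj pp *m (cp B *t 1%:M)).

Let hv_dp t : hv t dp = delta P (S t).
Proof.
rewrite /hv /dp /delta raddf_sum; apply: eq_bigr => k _ /=.
by rewrite -/(hv t _) hv_tens hv_Sp.
Qed.

Let hv_1 t m : hv t (1%:M : 'M_m) = 1%:M.
Proof. exact: map_mx1. Qed.

Let hv_pp t : hv t pp = pencil P A (S t).
Proof. by rewrite /hv map_mxB map_mxM -!/(hv t _) hv_1 hv_tens hv_1 hv_dp. Qed.

Let d_horner t : d.[t] = \det (pencil P A (S t)).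
Proof. by rewrite -hv_pp det_map_mx. Qed.

Let N_horner t : pencil P A (S t) \in unitmx ->
  hv t Np = d.[t] *: evaluation P A B G D (S t).
Proof.
move=> u; rewrite /hv map_mxD map_mxZ !map_mxM map_mx_adj -!/(hv t _) hv_pp.
rewrite !hv_tens !hv_1 hv_dp [LHS]/=.
rewrite /evaluation scalerDr; congr (_ + _).
rewrite /state /invmx u -!scalemxAl -!scalemxAr -d_horner scalerA mulfV ?scale1r //.
by rewrite d_horner -unitfE -unitmxE.
Qed.

Let e := \prod_k \det (1%:M + ('i)%:P *: Sp k).

Let e_horner t : e.[t] = \prod_k \det (1%:M + 'i *: S t k).
Proof.
rewrite horner_prod; apply: eq_bigr => k _.
rewrite -[LHS]/(horner_eval t _) -det_map_mx map_mxD map_mxZ -!/(hv t _) hv_1 hv_Sp.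
by rewrite /= /horner_eval hornerC.
Qed.

(** Natural numbers serve as real sample points. Conjugating coefficients turns the value at [t]
    into the conjugate of the value at [t^*], so the polynomial identity taken at ['i] involves the
    point [- 'i]. *)
Lemma hermitian_continuation :
  (forall k, 1%:M + 'i *: S 'i k \in unitmx) ->
  pencil P A (S 'i) \in unitmx -> pencil P A (S (- 'i)) \in unitmx ->
  (evaluation P A B G D (S (- 'i)))^t* = evaluation P A B G D (S 'i).
Proof.
move=> uS uP uP'.
have di : d.['i] != 0 by rewrite d_horner -unitfE -unitmxE.
have di' : d.[- 'i] != 0 by rewrite d_horner -unitfE -unitmxE.
have ei : e.['i] != 0.
  by rewrite e_horner; apply/prodf_neq0 => k _; rewrite -unitfE -unitmxE.
have nz (p : {poly C}) t : p.[t] != 0 -> p != 0.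
  by apply: contraNneq => ->; rewrite horner0.
have conjp (p : {poly C}) t : (map_poly Num.conj p).[t] = (p.[t^*])^*.
  by rewrite -{1}[t]conjCK horner_map.
apply/matrixP => s t.
pose p := Np s t * map_poly Num.conj d - map_poly Num.conj (Np t s) * d.
have p0 : p = 0.
  apply/eqP; have : p * (d * e) == 0.
    apply/eqP; apply: (@poly_eq0_inj _ (fun m => m%:R)) => [m m' /eqP|m].
      by rewrite eqr_nat => /eqP.
    rewrite !hornerM; have [d0|d0] := eqVneq d.[m%:R] 0; first by rewrite d0 mul0r mulr0.
    have [e0|e0] := eqVneq e.[m%:R] 0; first by rewrite e0 !mulr0.
    have uPm : pencil P A (S m%:R) \in unitmx by rewrite unitmxE unitfE -d_horner.
    have Nm a b : (Np a b).[m%:R] = d.[m%:R] * evaluation P A B G D (S m%:R) a b.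
      by have /matrixP/(_ a b) := N_horner uPm; rewrite !mxE.
    have hm : (evaluation P A B G D (S m%:R))^t* = evaluation P A B G D (S m%:R).
      apply: herm => // k; first by rewrite adjD adjZ S1h S2h rmorph_nat.
      move: e0; rewrite e_horner unitmxE unitfE => /prodf_neq0/(_ k); exact.
    rewrite hornerD hornerN !hornerM !conjp rmorph_nat !Nm rmorphM /=.
    have /matrixP/(_ s t) := hm; rewrite !mxE => ->.
    by rewrite mulrAC (mulrC d.[_]) [X in _ - X]mulrAC subrr mul0r.
  by rewrite !mulf_eq0 (negPf (nz _ _ di)) (negPf (nz _ _ ei)) !orbF.
have Ni u a b : pencil P A (S u) \in unitmx ->
    (Np a b).[u] = d.[u] * evaluation P A B G D (S u) a b.
  by move=> uPu; have /matrixP/(_ a b) := N_horner uPu; rewrite !mxE.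
have := congr1 (horner^~ 'i) p0; rewrite horner0 hornerD hornerN !hornerM !conjp conjCi.
rewrite (Ni _ _ _ uP) (Ni _ _ _ uP') rmorphM /= mulrAC [X in _ - X]mulrAC.
rewrite (mulrC (d.[- 'i])^* ) -mulrBr => /eqP; rewrite !mulf_eq0 (negPf di) conjC_eq0.
by rewrite (negPf di') /= subr_eq0 !mxE => /eqP ->.
Qed.

End HermitianContinuation.

Lemma hermitian_continuation_adj (C : numClosedFieldType) (N n r q : nat)
    (P : 'I_N -> 'M[C]_r) (A : 'M[C]_r) (B : 'M[C]_(r, q)) (G : 'M[C]_(q, r)) (D : 'M[C]_q) :
  (forall S : 'I_N -> 'M[C]_n, (forall k, (S k)^t* = S k) ->
    (forall k, 1%:M + 'i *: S k \in unitmx) -> pencil P A S \in unitmx ->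
    (evaluation P A B G D S)^t* = evaluation P A B G D S) ->
  forall W : 'I_N -> 'M[C]_n, (forall k, 1%:M + 'i *: W k \in unitmx) ->
    pencil P A W \in unitmx -> pencil P A (fun k => (W k)^t*) \in unitmx ->
    (evaluation P A B G D (fun k => (W k)^t*))^t* = evaluation P A B G D W.
Proof.
move=> herm W uW uP uP'.
pose S1 k := 2%:R^-1 *: (W k + (W k)^t*).
pose S2 k := - ('i / 2%:R) *: (W k - (W k)^t*).
have S1h k : (S1 k)^t* = S1 k.
  by rewrite adjZ fmorphV rmorph_nat adjD adjK addrC.
have S2h k : (S2 k)^t* = S2 k.
  rewrite /S2 adjZ rmorphN rmorphM /= conjCi fmorphV rmorph_nat adjD adjN adjK mulNr opprK.
  by rewrite scaleNr -scalerN opprB.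
have half : 2%:R^-1 + 2%:R^-1 = 1 :> C.
  by rewrite -mulr2n -(mulr_natr (2%:R^-1)) mulVf ?pnatr_eq0.
have Si : (fun k => S1 k + 'i *: S2 k) = W.
  apply/funext => k; rewrite /S1 /S2 scalerA mulrN mulrA -expr2 sqrCi mulN1r opprK.
  by rewrite -scalerDr addrACA subrr addr0 scalerDr -scalerDl half scale1r.
have Si' : (fun k => S1 k + (- 'i) *: S2 k) = (fun k => (W k)^t*).
  apply/funext => k; rewrite /S1 /S2 scalerA mulrNN mulrA -expr2 sqrCi mulN1r scaleNr.
  by rewrite -scalerBr opprB addrC addrA subrK scalerDr -scalerDl half scale1r.
rewrite -Si' -[X in _ = evaluation _ _ _ _ _ X]Si.
apply: hermitian_continuation => // [k||].
- by move/(congr1 (fun f => f k)): Si => /= ->.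
- by rewrite Si.
- by rewrite Si'.
Qed.

(** * Identities on the unit circle *)

Section UnitCircle.
Variable C : numClosedFieldType.

(** Cayley images of the natural numbers: infinitely many explicit points of the unit circle. *)
Definition circle_point (m : nat) : C := (1 + 'i * m%:R) / (1 - 'i * m%:R).

Let circle_den m : (1 - 'i * m%:R) * (1 + 'i * m%:R) = (1 + m ^ 2)%:R :> C.
Proof.
rewrite -subr_sqr expr1n exprMn sqrCi mulN1r opprK natrD natrX //.
Qed.

Let den_neq0 m : 1 - 'i * m%:R != 0 :> C.
Proof.
apply: contraTneq isT => e; have := circle_den m; rewrite e mul0r => /eqP.
by rewrite eq_sym pnatr_eq0.
Qed.

Let num_neq0 m : 1 + 'i * m%:R != 0 :> C.
Proof.
apply: contraTneq isT => e; have := circle_den m; rewrite e mulr0 => /eqP.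
by rewrite eq_sym pnatr_eq0.
Qed.

Lemma circle_point_conj m : circle_point m * (circle_point m)^* = 1.
Proof.
have cj : ('i * m%:R)^* = - ('i * m%:R) :> C by rewrite rmorphM /= conjCi rmorph_nat mulNr.
rewrite /circle_point fmorph_div rmorphD rmorphB rmorph1 /= cj opprK.
by rewrite mulf_div [X in X / _]mulrC mulfV ?mulf_neq0.
Qed.

Lemma circle_point_inj : injective circle_point.
Proof.
move=> m k /eqP; rewrite /circle_point eqr_div // => /eqP e.
have : 2%:R * 'i * m%:R - 2%:R * 'i * k%:R = 0 :> C.
  have -> : 2%:R * 'i * m%:R - 2%:R * 'i * k%:R
    = (1 + 'i * m%:R) * (1 - 'i * k%:R) - (1 + 'i * k%:R) * (1 - 'i * m%:R) :> C by ring.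
  by rewrite e subrr.
move=> /eqP; rewrite subr_eq0 => /eqP/mulfI h; apply/eqP; rewrite -(eqr_nat C).
by apply/eqP/h; rewrite mulf_neq0 ?pnatr_eq0 ?neq0Ci.
Qed.

Lemma poly_eq0_circle (p : {poly C}) : (forall c, c * c^* = 1 -> p.[c] = 0) -> p = 0.
Proof.
by move=> pc; apply: (poly_eq0_inj circle_point_inj) => m; apply: pc; apply: circle_point_conj.
Qed.

Lemma circle_nonroot (p : {poly C}) : p != 0 -> exists2 c, c * c^* = 1 & p.[c] != 0.
Proof.
move=> p0; apply: contrapT => h; move/eqP: p0; apply; apply: poly_eq0_circle => c cc.
by apply/eqP; apply: contrapT => /negP pc; apply: h; exists c.
Qed.

(** The conjugate of [p.[c]] is not polynomial in [c], but on the circle, where [c^*] is the inverse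
    of [c], it becomes so after multiplication by [c ^+ m]. *)
Definition conj_rev m (p : {poly C}) := \poly_(i < m.+1) (p`_(m - i))^*.

Lemma conj_rev_horner m (p : {poly C}) c : (size p <= m.+1)%N -> c * c^* = 1 ->
  (conj_rev m p).[c] = c ^+ m * (p.[c])^*.
Proof.
move=> pm cc; rewrite horner_poly (horner_coef_wide _ pm) rmorph_sum mulr_sumr.
rewrite (reindex_inj rev_ord_inj) /=; apply: eq_bigr => i _.
have im : (i <= m)%N by rewrite -ltnS.
rewrite subSS subKn // rmorphM rmorphXn mulrCA; congr (_ * _).
by rewrite -[X in c ^+ X * _](subnK im) exprD -mulrA -exprMn cc expr1n mulr1.
Qed.

(** After clearing denominators and reversing the conjugated polynomials, the claim is a polynomial
    identity on an infinite set; [e] marks exceptional points, which do not matter. *)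
Lemma circle_identity (p1 d1 p2 d2 e : {poly C}) : e != 0 ->
  (forall c, c * c^* = 1 -> e.[c] != 0 -> d1.[c] != 0 -> d2.[c] != 0 ->
     p1.[c] / d1.[c] = (p2.[c] / d2.[c])^*) ->
  forall c, c * c^* = 1 -> d1.[c] != 0 -> d2.[c] != 0 ->
    p1.[c] / d1.[c] = (p2.[c] / d2.[c])^*.
Proof.
move=> e0 h c cc d1c d2c.
have nz (p : {poly C}) t : p.[t] != 0 -> p != 0.
  by apply: contraNneq => ->; rewrite horner0.
pose m := maxn (size p2) (size d2).
have sp : (size p2 <= m.+1)%N by rewrite leqW ?leq_maxl.
have sd : (size d2 <= m.+1)%N by rewrite leqW ?leq_maxr.
pose Q := p1 * conj_rev m d2 - conj_rev m p2 * d1.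
have Q0 : Q = 0.
  apply/eqP; suff : Q * (e * (d1 * d2)) == 0.
    by rewrite !mulf_eq0 (negPf e0) (negPf (nz _ _ d1c)) (negPf (nz _ _ d2c)) !orbF.
  apply/eqP/poly_eq0_circle => t tt.
  have [e1|e1] := eqVneq e.[t] 0; first by rewrite !hornerM e1 mul0r mulr0.
  have [e2|e2] := eqVneq d1.[t] 0; first by rewrite !hornerM e2 mul0r !mulr0.
  have [e3|e3] := eqVneq d2.[t] 0; first by rewrite !hornerM e3 !mulr0.
  have := h t tt e1 e2 e3; rewrite fmorph_div => /eqP.
  rewrite eqr_div ?conjC_eq0 // => /eqP /= eq.
  rewrite hornerM hornerD hornerN !hornerM !conj_rev_horner // (mulrCA p1.[t]) eq.
  by rewrite (mulrA (t ^+ m)) subrr mul0r.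
have := congr1 (horner^~ c) Q0; rewrite horner0 hornerD hornerN !hornerM !conj_rev_horner //.
have c0 : c != 0 by apply/eqP => c0; move/eqP: cc; rewrite c0 mul0r eq_sym oner_eq0.
rewrite mulrCA -mulrA -mulrBr => /eqP; rewrite mulf_eq0 expf_eq0 (negPf c0) andbF /=.
by rewrite subr_eq0 => eq; apply/eqP; rewrite fmorph_div eqr_div ?conjC_eq0.
Qed.

End UnitCircle.

(** * Symmetry of the coefficients, and Hermitian values from the Stein equations *)

Section Selfadjoint.
Variables (C : numClosedFieldType) (N r q : nat) (P : 'I_N -> 'M[C]_r).
Hypotheses (P_proj : block_projectors P) (P_adj : forall k, (P k)^t* = P k).
Variables (A : 'M[C]_r) (B : 'M[C]_(r, q)) (G : 'M[C]_(q, r)) (D : 'M[C]_q).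

(** Entries of the Hankel matrix: the adjoint tail supplies the left part of the word, read
    backwards. *)
Lemma tail_adj_mul k u v :
  (tail P (A^t*) (G^t*) u)^t* *m P k *m tail P A B v = node_coef P A B G D (rev u ++ k :: v).
Proof.
elim: u k v => [|j u IHu] k v; first by rewrite /= adjK.
rewrite rev_cons cat_rcons -IHu /= !adjM !adjK P_adj.
by rewrite !mulmxA.
Qed.

(** At the shifts along [w] the corner entry from the first to the last position is the coefficient
    of [w]; at their adjoints the opposite corner is that of [rev w]. Nilpotency makes all matrices
    concerned invertible. *)
Lemma symmetric_coef :
  (forall n (W : 'I_N -> 'M[C]_n.+1), (forall k, 1%:M + 'i *: W k \in unitmx) ->
    pencil P A W \in unitmx -> pencil P A (fun k => (W k)^t*) \in unitmx ->
    (evaluation P A B G D (fun k => (W k)^t*))^t* = evaluation P A B G D W) ->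
  forall w, (node_coef P A B G D (rev w))^t* = node_coef P A B G D w.
Proof.
move=> herm w; pose W := @word_shift C N w.
have uP : pencil P A W \in unitmx.
  by apply: unit_pencil_triangular => k i j; apply: word_shift_increasing.
have uP' : pencil P A (fun k => (W k)^t*) \in unitmx.
  by apply: (@unit_pencil_triangular _ _ _ _ (@nat_of_ord _)) => k i j;
     apply: word_shift_adj_decreasing.
have uW k : 1%:M + 'i *: W k \in unitmx.
  rewrite -[_ *: _]opprK -scaleNr.
  apply: (unit_sub_triangular (mu := fun i => (size w - i)%N)) => i j.
  rewrite mxE mulf_eq0 negb_or => /andP[_]; exact: word_shift_increasing.
apply/matrixP => s t.
rewrite -(path_evaluation B G D uP s t (path_word_shift C w)) blkE -herm //.
rewrite !adjE -(path_evaluation B G D uP' t s (path_word_shift_adj C w)).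
by rewrite blkE.
Qed.

Section Stein.
Variable H : 'M[C]_r.
Hypotheses (HP : forall k, H *m P k = P k *m H) (H_adj : H^t* = H).
Hypotheses (AHA : A^t* *m H *m A = H) (DHD : D - D^t* = 'i *: (B^t* *m H *m B)).
Hypothesis GHG : G = 'i *: (B^t* *m H *m A).
Variables (n : nat) (Z : 'I_N -> 'M[C]_n).
Hypotheses (Zu : forall k, Z k \is unitarymx) (uP : pencil P A Z \in unitmx).

Lemma adj_tens m p a b (X : 'M[C]_(m, p)) (Y : 'M[C]_(a, b)) : (X *t Y)^t* = X^t* *t Y^t*.
Proof. by rewrite trmx_tens map_mxT. Qed.

(** For the state [X] and [Y = Dl *m X], unitarity makes the [Ht]-forms of [X] and [Y] equal.
    Expanding [X = Bt + At *m Y] and using [AHA] expresses [Bt^t* *m Ht *m Bt] as minus twice the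
    Hermitian part of [Bt^t* *m Ht *m At *m Y]; with [DHD] this is the claim. *)
Lemma stein_hermitian : (evaluation P A B G D Z)^t* = evaluation P A B G D Z.
Proof.
set X := state P A B Z; set Dl := delta P Z; pose Y := Dl *m X.
pose At : 'M_(r * n) := A *t 1%:M; pose Bt : 'M_(r * n, q * n) := B *t 1%:M.
pose Ht : 'M_(r * n) := H *t 1%:M.
have DlH : Dl^t* *m Ht *m Dl = Ht.
  have -> : Dl^t* = delta P (fun k => (Z k)^t*).
    by rewrite /Dl /delta adj_sum; apply: eq_bigr => k _; rewrite adj_tens P_adj.
  have -> : delta P (fun k => (Z k)^t*) *m Ht = Ht *m delta P (fun k => (Z k)^t*).
    rewrite /Ht tens_delta /delta mulmx_suml; apply: eq_bigr => k _.
    by rewrite tensmx_mul mulmx1 HP.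
  rewrite -mulmxA (deltaM P_proj) -[RHS]mulmx1 -(delta1 n P_proj); congr (_ *m delta _ _).
  by apply/funext => k; apply: mulmx1C; apply/unitarymxP.
have defX : X = Bt + At *m Y.
  have : pencil P A Z *m X = Bt by rewrite /X /state mulKVmx.
  by rewrite /pencil mulmxBl mul1mx -mulmxA -/Dl -/Y => <-; rewrite subrK.
have XHX : X^t* *m Ht *m X = Y^t* *m Ht *m Y.
  by rewrite /Y (adjM Dl) !mulmxA -(mulmxA _ (Dl^t*)) -(mulmxA _ (_ *m Ht)) DlH.
have Htadj : Ht^t* = Ht by rewrite adj_tens H_adj adj1.
have AHt : At^t* *m Ht *m At = Ht by rewrite adj_tens adj1 !tensmx_mul !mulmx1 AHA.
have Gt : G *t 1%:M = 'i *: (Bt^t* *m Ht *m At) :> 'M_(q * n, r * n).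
  by rewrite adj_tens adj1 !tensmx_mul !mulmx1 -tensmxZl -GHG.
have Dt : D *t 1%:M = (D *t 1%:M)^t* + 'i *: (Bt^t* *m Ht *m Bt) :> 'M_(q * n).
  rewrite !adj_tens adj1 !tensmx_mul !mulmx1 -tensmxZl -tensmxDl.
  by rewrite -DHD addrC subrK.
have ev : evaluation P A B G D Z = D *t 1%:M + 'i *: (Bt^t* *m Ht *m At *m Y).
  by rewrite /evaluation -mulmxA -/X -/Dl -/Y Gt -scalemxAl.
rewrite ev adjD adjZ conjCi [in RHS]Dt -addrA; congr (_ + _).
have : X^t* *m Ht *m X = Bt^t* *m Ht *m Bt + Bt^t* *m Ht *m At *m Y
    + (Bt^t* *m Ht *m At *m Y)^t* + Y^t* *m Ht *m Y.
  have Xadj : X^t* = Bt^t* + Y^t* *m At^t* by rewrite {1}defX adjD (adjM At).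
  have -> : (Bt^t* *m Ht *m At *m Y)^t* = Y^t* *m At^t* *m Ht *m Bt.
    by rewrite (adjM _ Y) (adjM _ At) (adjM (Bt^t*)) Htadj adjK !mulmxA.
  transitivity ((Bt^t* + Y^t* *m At^t*) *m Ht *m (Bt + At *m Y)).
    by rewrite -Xadj -defX.
  have -> : Y^t* *m Ht *m Y = Y^t* *m At^t* *m Ht *m (At *m Y).
    by rewrite -[in LHS]AHt !mulmxA.
  by rewrite mulmxDl mulmxDr !(mulmxDl, mulmxDr) addrACA addrA !mulmxA.
rewrite XHX -[LHS]add0r => /addIr /esym/eqP; rewrite addr_eq0 => /eqP e.
by rewrite scaleNr -scalerDr e scalerN.
Qed.

End Stein.
End Selfadjoint.

(** * The theorem *)

Lemma tidx_surj n q (u : 'I_(q * n)) : exists s, tidx s = u :> 'I_(q * n).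
Proof.
case: (mxtens_indexP u) => a i; exists (tagnat.Rank (p_ := fun=> n) a i).
rewrite /tidx tagnat.Rank1K; congr (mxtens_index (_, _)).
by rewrite tagnat.Rank2K; apply: val_inj.
Qed.

Section MainProof.
Variables (C : numClosedFieldType) (N q r : nat) (P : 'I_N -> 'M[C]_r).
Hypotheses (P_proj : block_projectors P) (P_adj : forall k, (P k)^t* = P k).
Variables (A : 'M[C]_r) (B : 'M[C]_(r, q)) (G : 'M[C]_(q, r)) (D : 'M[C]_q).
Variable Psi : mxfps C N q.
Hypothesis PsiE : Psi = node_coef P A B G D.

Lemma selfadjoint_evaluation : mxfps_rational Psi -> matrix_selfadjoint_on_T Psi ->
  forall n (Z : 'I_N -> 'M[C]_n.+1), (forall k, Z k \is unitarymx) ->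
    pencil P A Z \in unitmx -> (evaluation P A B G D Z)^t* = evaluation P A B G D Z.
Proof.
move=> rat sa n Z Zu uP.
have /fin_all_exists[E rE] : forall a, exists E, forall b, represents (E b) (fun w => Psi w a b).
  by move=> a; have [E rE] := fin_all_exists (rat a); exists E.
pose V := \matrix_(s, t) evaluation P A B G D Z (tidx s) (tidx t).
have /matrixP VV : V = V^t*.
  apply: (sa n.+1 isT Z Zu); exists E; split=> // s t; rewrite [V s t]mxE.
  have rE' a b : represents (E a b) (fun w => node_coef P A B G D w a b) by rewrite -PsiE.
  exact (rational_mxfun_value s t rE' uP).
apply/matrixP => u v; rewrite adjE.
have [s <-] := tidx_surj u; have [t <-] := tidx_surj v.
by have := VV s t; rewrite !mxE.
Qed.

Section Converse.
Variable H : 'M[C]_r.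
Hypotheses (HP : forall k, H *m P k = P k *m H) (H_adj : H^t* = H).
Hypotheses (AHA : A^t* *m H *m A = H) (DHD : D - D^t* = 'i *: (B^t* *m H *m B)).
Hypothesis GHG : G = 'i *: (B^t* *m H *m A).

(** The power series may be defined at [Z] although the pencil is singular there, so the computation
    is made at nearby multiples of [Z] and extended by [circle_identity]. *)
Lemma stein_selfadjoint : matrix_selfadjoint_on_T Psi.
Proof.
move=> n _ Z Zu V [E [rE EV]].
have rE' a b : represents (E a b) (fun w => node_coef P A B G D w a b).
  by rewrite -PsiE.
pose line (p : {mpoly C[#|entry N n|]}) : {poly C} :=
  mmap polyC (fun m => 'X * (coords Z m)%:P) p.
have lineE p c : (line p).[c] = p.@[coords (fun k => c *: Z k)].
  rewrite /line /mmap horner_sum mevalE; apply: eq_bigr => m _.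
  rewrite hornerM hornerC; congr (_ * _).
  rewrite /mmap1 horner_prod; apply: eq_bigr => i _.
  rewrite horner_exp hornerM hornerX hornerC; congr (_ ^+ _).
  by rewrite /coords; case: (enum_val i) => -[? ?] ?; rewrite mxE.
pose M : 'M_(r * n) := (A *t 1%:M) *m delta P Z.
pose e : {poly C} := \det (1%:M - 'X *: map_mx polyC M).
have eE c : e.[c] = \det (pencil P A (fun k => c *: Z k)).
  rewrite -[LHS]/(horner_eval c _) -det_map_mx /pencil deltaZ -scalemxAr -/M.
  rewrite map_mxB map_mx1 map_mxZ /= {1}/horner_eval hornerX; congr (\det (_ - _ *: _)).
  by apply/matrixP => i j; rewrite [LHS]mxE [X in horner_eval c X]mxE /horner_eval hornerC.
(* At [c = 0] the pencil is the identity, so it is singular for only finitely many [c]. *)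
have e0 : e != 0.
  apply: contraTneq isT => e0; have := eE 0; rewrite e0 horner0 /pencil deltaZ scale0r.
  by rewrite mulmx0 subr0 det1 => /eqP; rewrite eq_sym oner_eq0.
have Z1 : (fun k => 1 *: Z k) = Z by apply/funext => k; rewrite scale1r.
apply/matrixP => s t; rewrite adjE.
have [p1 [d1 [d10 x1 ->]]] := EV s t; have [p2 [d2 [d20 x2 ->]]] := EV t s.
have := @circle_identity C (line p1) (line d1) (line p2) (line d2) e e0 _ 1.
rewrite !lineE Z1; apply => //; last by rewrite rmorph1 mulr1.
move=> c cc ec; rewrite !lineE => d1c d2c.
have uP : pencil P A (fun k => c *: Z k) \in unitmx by rewrite unitmxE unitfE -eE.
have cu k : c *: Z k \is unitarymx.
  apply/unitarymxP; rewrite adjZ -scalemxAl -scalemxAr scalerA cc scale1r.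
  exact/unitarymxP.
have v1 : ratfun_value (rational_mxfun n E s t) (fun k => c *: Z k)
    (p1.@[coords (fun k => c *: Z k)] / d1.@[coords (fun k => c *: Z k)]).
  by exists p1, d1.
have v2 : ratfun_value (rational_mxfun n E t s) (fun k => c *: Z k)
    (p2.@[coords (fun k => c *: Z k)] / d2.@[coords (fun k => c *: Z k)]).
  by exists p2, d2.
rewrite (fval_uniq (@frac_inj C N n) v1 (rational_mxfun_value s t rE' uP)).
rewrite (fval_uniq (@frac_inj C N n) v2 (rational_mxfun_value t s rE' uP)).
by rewrite -adjE (stein_hermitian P_proj P_adj HP H_adj AHA DHD GHG cu uP).
Qed.

End Converse.

Lemma selfadjoint_stein : controllable P A B -> controllable P (A^t*) (G^t*) ->
  mxfps_rational Psi -> matrix_selfadjoint_on_T Psi ->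
  exists H : 'M[C]_r, [/\ H \in unitmx, H^t* = H, forall k, H *m P k = P k *m H &
    [/\ A^t* *m H *m A = H, D - D^t* = 'i *: (B^t* *m H *m B)
      & G = 'i *: (B^t* *m H *m A)]].
Proof.
move=> ctrlB ctrlG rat sa.
(* The characteristic polynomial does not vanish on the whole circle, so some unimodular [l] is not
   an eigenvalue of [A]. *)
have [l ll lA] := circle_nonroot (monic_neq0 (char_poly_monic A)).
pose R := invmx (l%:M - A).
have RA : R *m (l%:M - A) = 1%:M.
  rewrite mulVmx // unitmxE unitfE.
  move: lA; rewrite /char_poly -[_.[l]]/(horner_eval l _) -det_map_mx.
  suff -> : map_mx (horner_eval l) (char_poly_mx A) = l%:M - A by [].
  apply/matrixP => i j; rewrite !mxE /= /horner_eval hornerD hornerN hornerC.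
  by rewrite hornerMn hornerX.
have RA' : R^t* *m ((l^*)%:M - A^t*) = 1%:M.
  by rewrite -adj_scalar -adjN -adjD -adjM (mulmx1C RA) adj1.
pose a := - (2%:R * 'i * l).
have a0 : a != 0.
  rewrite oppr_eq0 !mulf_neq0 ?pnatr_eq0 ?neq0Ci //.
  by apply/eqP => l0; move/eqP: ll; rewrite l0 mul0r eq_sym oner_eq0.
pose A1 := cayA R l; pose B1 := cayB R B; pose G1 := cayC R G l; pose D1 := cayD R B G D.
have A1adj : A1^t* = a^* *: R^t* + (- 'i)%:M by rewrite adjD adjZ adj_scalar conjCi.
have G1adj : G1^t* = a^* *: (R^t* *m G^t*) by rewrite adjZ adjM.
have ctrlB1 : controllable P A1 B1.
  rewrite /B1 /cayB -[R *m B]scale1r.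
  exact: (controllable_resolvent RA a0 (oner_neq0 C) ctrlB).
have a'0 : a^* != 0 by rewrite conjC_eq0.
have ctrlG1 : controllable P (A1^t*) (G1^t*).
  by rewrite A1adj G1adj; exact: (controllable_resolvent RA').
have herm n (S : 'I_N -> 'M[C]_n.+1) : (forall k, (S k)^t* = S k) ->
    (forall k, 1%:M + 'i *: S k \in unitmx) -> pencil P A1 S \in unitmx ->
    (evaluation P A1 B1 G1 D1 S)^t* = evaluation P A1 B1 G1 D1 S.
  move=> Sh uS uP.
  rewrite -(evaluation_cayley P_proj B G D ll RA uS uP).
  apply: selfadjoint_evaluation => // [k|]; first exact: cayley_unitary.
  exact: (pencil_cayley_unit P_proj ll RA uS uP).
have sym := symmetric_coef (fun n => hermitian_continuation_adj (herm n)).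
have D1h : D1 = D1^t* by have := sym [::]; rewrite /= => ->.
(* Both sides are Hankel entries, at [rev u ++ k :: v] and, conjugated, at its reversal
   [rev v ++ k :: u]; [sym] equates them. *)
have f12 k u v : (tail P (A1^t*) (G1^t*) u)^t* *m P k *m tail P A1 B1 v
    = (tail P A1 B1 u)^t* *m P k *m tail P (A1^t*) (G1^t*) v.
  rewrite (tail_adj_mul P_adj _ _ _ D1) -sym -[RHS]adjK; congr (_^t*).
  rewrite adjM adjM P_adj adjK mulmxA (tail_adj_mul P_adj _ _ _ D1).
  by rewrite rev_cat rev_cons cat_rcons revK.
have [T [uT Tadj TP TA TB]] := hermitian_similarity P_proj P_adj ctrlB1 ctrlG1 f12.
have [AHA DHD GHG] := cayley_node_stein ll RA Tadj TA TB D1h.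
exists (- 2%:R^-1 *: T); split=> //.
- by rewrite unitmxZ // unitfE oppr_eq0 invr_eq0 pnatr_eq0.
- by rewrite adjZ Tadj rmorphN fmorphV rmorph_nat.
- by move=> k; rewrite -scalemxAl TP scalemxAr.
Qed.

End MainProof.

(** * Block diagonal matrices and the final assembly *)

Lemma submxblock_mxdiag0 (C : fieldType) (N : nat) (g : 'I_N -> nat)
    (Hk : forall k, 'M[C]_(g k)) j k :
  j != k -> submxblock (\mxdiag_i Hk i) j k = 0.
Proof. by move=> jk; rewrite mxblockK (negPf jk). Qed.

Lemma blocksel_proj (C : fieldType) (N : nat) (g : 'I_N -> nat) j k :
  blocksel C g j *m blockproj C g k = if j == k then blocksel C g j else 0.
Proof.
rewrite mulmxA mul_blocksel; case: eqP => [->|/eqP jk]; first by rewrite submxblock1 mul1mx.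
by rewrite -mxdiagZ submxblock_mxdiag0 // mul0mx.
Qed.

Lemma blockproj_sel (C : fieldType) (N : nat) (g : 'I_N -> nat) j k :
  blockproj C g k *m (blocksel C g j)^T = if j == k then (blocksel C g j)^T else 0.
Proof.
rewrite -[blockproj _ _ _]trmxK -trmx_mul blockproj_tr blocksel_proj.
by case: eqP => // _; rewrite trmx0.
Qed.

(** Inserting [blockproj C g i] before [H] in the block [(i, j)] and moving it past [H] kills the
    block when [i] and [j] differ. *)
Lemma mxdiag_commute (C : fieldType) (N : nat) (g : 'I_N -> nat) (H : 'M[C]_(\sum_i g i)) :
  (forall k, H *m blockproj C g k = blockproj C g k *m H) <->
  H = \mxdiag_k submxblock H k k.
Proof.
split=> [HP|defH k]; apply/mxblockP => i j.
  have [<-|ij] := eqVneq i j; first by rewrite submxblock_diag.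
  rewrite submxblock_mxdiag0 // submxblockE.
  have -> : blocksel C g i = blocksel C g i *m blockproj C g i by rewrite blocksel_proj eqxx.
  rewrite -(mulmxA (blocksel C g i)) -HP -(mulmxA (blocksel C g i)) -(mulmxA H).
  rewrite blockproj_sel eq_sym (negPf ij).
  by rewrite !mulmx0.
rewrite !submxblockE [in RHS](mulmxA _ (blockproj C g k)) blocksel_proj.
rewrite -[in LHS](mulmxA (blocksel C g i)) -[in LHS](mulmxA H) blockproj_sel.
have [<-|ij] := eqVneq i j.
  by case: eqP => _; rewrite ?mulmx0 ?mul0mx ?mulmxA.
have Hij : blocksel C g i *m H *m (blocksel C g j)^T = 0.
  by rewrite -submxblockE defH submxblock_mxdiag0.
by case: eqP => _; case: eqP => _; rewrite ?mulmx0 ?mul0mx // ?mulmxA ?Hij.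
Qed.

Theorem theorem7p11 (R : realType) (N q : nat) (Psi : mxfps R[i] N q)
    (gamma : 'I_N -> nat) (alpha : gr_node R[i] q gamma) :
  mxfps_rational Psi ->
  minimal_gr_realization Psi alpha ->
  matrix_selfadjoint_on_T Psi <->
  exists Hk : forall k : 'I_N, 'M[R[i]]_(gamma k),
    let H := \mxdiag_(k < N) Hk k in
    [/\ H \in unitmx,
        H = H^t*,
        (gr_A alpha)^t* *m H *m gr_A alpha = H,
        gr_D alpha - (gr_D alpha)^t* = 'i *: ((gr_B alpha)^t* *m H *m gr_B alpha)
      & gr_C alpha = 'i *: ((gr_B alpha)^t* *m H *m gr_A alpha)].
Proof.
move=> rat min.
have PsiE : Psi = node_coef (blockproj R[i] gamma) (gr_A alpha) (gr_B alpha)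
    (gr_C alpha) (gr_D alpha).
  by apply/funext => w; rewrite -(proj1 min) transferE.
have Pp := blockproj_projectors R[i] gamma; have Pa := @blockproj_adj R[i] N gamma.
split=> [sa|[Hk /= [_ Hadj AHA DHD GHG]]].
  have [H [uH Hadj HP [AHA DHD GHG]]] := selfadjoint_stein Pp Pa PsiE
    (minimal_controllable min) (minimal_observable min) rat sa.
  exists (fun k => submxblock H k k) => /=.
  by rewrite -(proj1 (mxdiag_commute H) HP) Hadj.
apply: (stein_selfadjoint Pp Pa PsiE _ (esym Hadj) AHA DHD GHG).
apply/mxdiag_commute; apply: eq_mxdiag => k.
by rewrite submxblock_diag.
Qed.
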